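(* Let $m,n\in\mathbb{N}$ with $m,n\geq 3$, and let $\Lambda$ be a cyclotomic model set with underlying $\mathbb{Z}$-module $\mathcal{O}_n$. Then the following statements are equivalent: (i) There is an affinely regular $m$-gon in $\Lambda$. (ii) $\mathbb{k}_m\subset\mathbb{k}_n$. (iii) $m\in\{3,4,6\}$, or $\mathbb{K}_m\subset\mathbb{K}_n$. (iv) $m\in\{3,4,6\}$, or $m\mid n$, or $m=2d$ with $d$ an odd divisor of $n$. (v) $m\in\{3,4,6\}$, or $\mathcal{O}_m\subset\mathcal{O}_n$. (vi) $\mathbb{Z}[\zeta_m+\bar\zeta_m]\subset\mathbb{Z}[\zeta_n+\bar\zeta_n]$.
   Context: $\mathbb{N}=\{1,2,3,\dots\}$; $\mathbb{R}^2$ is identified with $\mathbb{C}$. For $n\in\mathbb{N}$: $\zeta_n:=e^{2\pi i/n}$, $\mathbb{K}_n:=\mathbb{Q}(\zeta_n)$, $\mathbb{k}_n:=\mathbb{Q}(\zeta_n+\bar\zeta_n)$ and $\mathcal{O}_n:=\mathbb{Z}[\zeta_n]$; $\phi$ is Euler's function. Cyclotomic model sets: let $n\ge 3$. Choose automorphisms $\sigma_1=\mathrm{id},\sigma_2,\dots,\sigma_{\phi(n)/2}$ of $\mathbb{K}_n/\mathbb{Q}$ by picking exactly one from each pair of complex conjugate automorphisms, and let the star map $\star:\mathcal{O}_n\to(\mathbb{R}^2)^{\phi(n)/2-1}$ be $z\mapsto z^\star:=(\sigma_2(z),\dots,\sigma_{\phi(n)/2}(z))$ (for $n\in\{3,4,6\}$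 the target is the one-point space $\{0\}$ and the star map is the zero map). A window is a set $W\subset(\mathbb{R}^2)^{\phi(n)/2-1}$ with $\emptyset\neq \operatorname{int}(W)\subset W\subset\overline{\operatorname{int}(W)}$ and $\overline{\operatorname{int}(W)}$ compact. A cyclotomic model set with underlying $\mathbb{Z}$-module $\mathcal{O}_n$ is a set of the form $\Lambda=t+\{z\in\mathcal{O}_n \mid z^\star\in W\}$ with $t\in\mathbb{R}^2$, $W$ a window, and $\star$ any such star map. A polygon in a set $S\subset\mathbb{R}^2$ is a convex polygon (convex hull of a finite set of points) all of whose vertices lie in $S$. Regular polygons are assumed to be planar, non-degenerate and convex. An affinely regular polygon is the image of a regular polygon under a non-singular affine transformation $z\mapsto Az+t$ of the plane ($A$ an invertible real $2\times 2$ matrix, $t\in\mathbb{R}^2$); an affinely regular $m$-gon is one with exactly $m$ vertices. *)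

(* Defs.v *)
From HB Require Import structures.
From mathcomp Require Import all_boot all_order all_algebra.
From mathcomp Require Import all_classical all_reals all_analysis.
From mathcomp Require Import complex.

Set Implicit Arguments.
Unset Strict Implicit.
Unset Printing Implicit Defensive.

Import Order.TTheory GRing.Theory Num.Theory.
Import numFieldNormedType.Exports.

Local Open Scope classical_set_scope.
Local Open Scope complex_scope.
Local Open Scope ring_scope.

(* The Euclidean plane is R[i], for an arbitrary R : realType. *)

Section CyclotomicRings.
Context (R : realType).
Local Notation C := R[i].

Definition zeta (n : nat) : C :=
  cos (2 * pi / n%:R) +i* sin (2 * pi / n%:R).

(* Q(x) and Z[x]; a subfield of C automatically contains Q. *)
Definition Qadjoin (x : C) : set C :=
  smallest (fun F : set C => GRing.divring_closed (mem F)) [set x].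

Definition Zadjoin (x : C) : set C :=
  smallest (fun A : set C => GRing.subring_closed (mem A)) [set x].

Definition Kfield (n : nat) : set C := Qadjoin (zeta n).
Definition kfield (n : nat) : set C := Qadjoin (zeta n + (zeta n)^*%C).
Definition Oring (n : nat) : set C := Zadjoin (zeta n).
Definition oring (n : nat) : set C := Zadjoin (zeta n + (zeta n)^*%C).

End CyclotomicRings.

Arguments zeta : clear implicits.
Arguments Kfield : clear implicits.
Arguments kfield : clear implicits.
Arguments Oring : clear implicits.
Arguments oring : clear implicits.

Section ModelSets.
Context (R : realType).
Local Notation C := R[i].

(* f represents an automorphism of K/Q; its values outside K are irrelevant. *)
Definition is_automorphism (K : set C) (f : C -> C) : Prop :=
  [/\ set_bij K K f,
      {in K &, {morph f : x y / x + y}},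
      {in K &, {morph f : x y / x * y}} &
      forall q : rat, f (ratr q) = ratr q].

(* phi(n)/2 - 1; for n >= 3, (sdim n).+1 is phi(n)/2. *)
Definition sdim (n : nat) : nat := (totient n)./2.-1.

(* sigma ord0 is the sigma_1 = id of the usual numbering; the [exists!] says
   that sigma meets each pair {tau, conj o tau} exactly once. *)
Definition is_automorphism_choice (n : nat)
    (sigma : 'I_(sdim n).+1 -> C -> C) : Prop :=
  [/\ forall j, is_automorphism (Kfield R n) (sigma j),
      {in Kfield R n, sigma ord0 =1 id} &
      forall tau, is_automorphism (Kfield R n) tau ->
        exists! j, {in Kfield R n, sigma j =1 tau} \/
                   {in Kfield R n, sigma j =1 (fun z => (tau z)^*%C)}].

(* C^o carries the Euclidean topology and 'rV[C^o]_s the product topology. *)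
Definition star (n : nat) (sigma : 'I_(sdim n).+1 -> C -> C) (z : C) :
    'rV[C^o]_(sdim n) :=
  \row_j sigma (lift ord0 j) z.

Definition is_window (s : nat) (W : set 'rV[C^o]_s) : Prop :=
  [/\ W° !=set0, W `<=` closure W° & compact (closure W°)].

Definition is_cyclotomic_model_set (n : nat) (L : set C) : Prop :=
  exists (t : C) (W : set 'rV[C^o]_(sdim n))
         (sigma : 'I_(sdim n).+1 -> C -> C),
    [/\ is_window W, is_automorphism_choice sigma &
        L = [set t + z | z in [set z | Oring R n z /\ W (star sigma z)]]].

End ModelSets.

Section Polygons.
Context (R : realType).
Local Notation C := R[i].

(* Rcomplex R is R[i] seen as a vector space over R. *)
Definition conv_hull (A : set C) : set C :=
  smallest (fun B : set C => @convex_set R (Rcomplex R) B) A.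

(* The vertices of a convex polygon are its extreme points. *)
Definition vertices (P : set C) : set C :=
  [set x | P x /\ forall (y z : C) (t : R), P y -> P z -> 0 < t < 1 ->
             x = (1 - t)%:C * y + t%:C * z -> y = z].

Definition is_convex_polygon (P : set C) : Prop :=
  exists2 A : set C, finite_set A & P = conv_hull A.

Definition is_polygon_in (S P : set C) : Prop :=
  is_convex_polygon P /\ vertices P `<=` S.

(* k >= 3 equally spaced points on a circle of centre c and radius `|r|. *)
Definition is_regular_polygon (P : set C) : Prop :=
  exists (k : nat) (c r : C),
    [/\ (3 <= k)%N, r != 0 &
        P = conv_hull [set c + r * zeta R k ^+ (val j) | j in [set: 'I_k]]].

Definition affine_map (A : 'M[R]_2) (t z : C) : C :=
  let v := A *m \col_(j < 2) (if j == 0 then complex.Re z else complex.Im z) in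
  (v 0 0 +i* v 1 0) + t.

Definition is_affinely_regular_polygon (P : set C) : Prop :=
  exists (A : 'M[R]_2) (t : C) (Q : set C),
    [/\ A \in unitmx, is_regular_polygon Q & P = affine_map A t @` Q].

Definition is_affinely_regular_gon (m : nat) (P : set C) : Prop :=
  is_affinely_regular_polygon P /\ (vertices P #= `I_m)%card.

End Polygons.

(* Main.v *)
(* A regular m-gon has a diagonal parallel to an edge with ratio
   1 + zeta_m + zeta_m^-1, and affine maps preserve this ratio.  For vertices in
   a translate of O_n the ratio is a real element of K_n, so it lies in k_n.

   Conversely, let k_m be contained in k_n.  Writing zeta_m + zeta_m^-1 as a
   rational polynomial in zeta_n and applying the irreducibility of the
   cyclotomic polynomial of order mn, every integer prime to mn that is 1 mod n
   is +-1 mod m, and elementary arithmetic forces m | n, m = 2d with d an odd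
   divisor of n, or m in {3, 4, 6}.  Then zeta_m is a power of zeta_n up to sign,
   or zeta_m + zeta_m^-1 is an integer, which gives all inclusions of rings and
   fields.

   To find the polygon, shear the regular m-gon by the real-linear map fixing 1
   and sending zeta_m to zeta_n; its vertices become elements of O_n.  By
   pigeonhole there is a nonzero lambda in O_n whose conjugates under
   sigma_2, sigma_3, ... are tiny, and multiples of lambda have dense star
   images, so a similarity z |-> v + lambda z over O_n moves the star images of
   all vertices into a ball inside the window. *)
Require Import Defs.
From HB Require Import structures.
From mathcomp Require Import all_boot all_order all_algebra all_field.
From mathcomp Require Import all_classical all_reals all_analysis.
From mathcomp Require Import complex.
From mathcomp Require Import zify ring lra.

Set Implicit Arguments.
Unset Strict Implicit.
Unset Printing Implicit Defensive.

Import Order.TTheory GRing.Theory Num.Theory.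

Local Open Scope classical_set_scope.
Local Open Scope complex_scope.
Local Open Scope ring_scope.

(** * Units modulo m that are 1 modulo n *)

Section Arithmetic.

(** Chinese remaindering for moduli that need not be coprime: with b - 1 = s g for g = gcd(m, n),
    and a Bezout relation u n = v m + g, the number s u n + 1 = s v m + b has both residues. *)
Lemma lift_unit_eq1 (m n b : nat) : (0 < n)%N -> (0 < b)%N -> coprime b m ->
  b = 1 %[mod gcdn m n] ->
  exists x, [/\ x = b %[mod m], x = 1 %[mod n], coprime x m & coprime x n].
Proof.
move=> n_gt0 b_gt0 cbm /eqP; rewrite eqn_mod_dvd // => /dvdnP[s bE].
case: (egcdnP m n_gt0) => u v uv _.
have xE : (s * u * n + 1 = s * v * m + b)%N.
  have -> : b = (s * gcdn n m + 1)%N by rewrite gcdnC -bE subnK.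
  by rewrite -mulnA uv mulnDr mulnA addnA.
have xm : (s * u * n + 1 = b %[mod m])%N by rewrite xE modnMDl.
have xn : (s * u * n + 1 = 1 %[mod n])%N by rewrite modnMDl.
exists (s * u * n + 1)%N; split => //.
- by rewrite -coprime_modl xm coprime_modl.
- by rewrite -coprime_modl xn coprime_modl coprime1n.
Qed.

(** One test unit settles each case: 2 for odd m, and for m = 2 h either h + 1 (h even) or h + 2 (h
    odd). The hypothesis on it bounds m, leaving 3, 4 and 6 respectively. *)
Lemma all_units_pm1 m : (3 <= m)%N ->
  (forall b, coprime b m -> b = 1 %[mod m] \/ (m %| b.+1)%N) ->
  m \in [:: 3; 4; 6]%N.
Proof.
move=> m3 H; have m0 : (0 < m)%N by lia.
have pm b : (0 < b)%N -> coprime b m -> (m %| b.-1)%N \/ (m %| b.+1)%N.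
  move=> b0 /H[/eqP|]; last by right.
  by rewrite eqn_mod_dvd // subn1; left.
have [mo|me] := boolP (odd m).
  case: (pm 2); rewrite ?coprime2n //=.
    by rewrite dvdn1; lia.
  by move=> /dvdn_leq; rewrite !inE; lia.
have [h mE] : exists h, m = (2 * h)%N by exists m./2; lia.
have [ho|he] := boolP (odd h); last first.
  have c : coprime h.+1 m by rewrite mE coprimeMr coprimen2 /= he coprime_sym coprimenS.
  have [//|/dvdn_leq|/dvdn_leq] := pm _ _ c; rewrite !inE; lia.
have c : coprime h.+2 m.
  rewrite mE coprimeMr coprimen2 /= negbK ho /= -[h.+2]addn2.
  by rewrite /coprime gcdnC gcdnDl -/(coprime _ _) coprimen2.
have [//|/dvdn_leq|/dvdn_leq] := pm _ _ c; rewrite !inE; lia.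
Qed.

Lemma dvdn_of_units_pm1 m n : (3 <= m)%N -> (3 <= n)%N ->
  (forall b, coprime b m -> coprime b n -> b = 1 %[mod n] ->
     b = 1 %[mod m] \/ (m %| b.+1)%N) ->
  [\/ m \in [:: 3; 4; 6]%N, (m %| n)%N |
         exists d : nat, [/\ odd d, (d %| n)%N & m = (2 * d)%N]].
Proof.
move=> m3 n3 H; have m0 : (0 < m)%N by lia.
have n0 : (0 < n)%N by lia.
set g := gcdn m n; have g0 : (0 < g)%N by rewrite gcdn_gt0 m0.
have pm b : coprime b m -> b = 1 %[mod g] -> b = 1 %[mod m] \/ (m %| b.+1)%N.
  move=> cb b1; have b0 : (0 < b)%N.
    by rewrite lt0n; apply: contraTneq cb => ->; rewrite /coprime gcd0n; lia.
  have [x [xm xn cxm cxn]] := lift_unit_eq1 n0 b0 cb b1.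
  have [x1|x1] := H x cxm cxn xn; [left|right]; first by rewrite -xm.
  by rewrite /dvdn -addn1 -modnDml -xm modnDml addn1.
have gm : (g %| m)%N := dvdn_gcdl m n.
have gn : (g %| n)%N := dvdn_gcdr m n.
(* For g at most 2, every unit mod m is 1 mod g, so all units mod m are 1 or -1. *)
case: (leqP g 2) => g2.
  constructor 1; apply: all_units_pm1 => // b cb; apply: pm => //.
  have : (coprime b g) by apply: coprime_dvdr cb.
  case: (g) g0 g2 => [|[|[|]]] // _ _; first by rewrite !modn1.
  by rewrite coprimen2 !modn2 => ->.
(* For g at least 3 the sign -1 is excluded: g would divide both b - 1 and b + 1, hence 2. *)
have pm1 b : (0 < b)%N -> coprime b m -> (g %| b.-1)%N -> (m %| b.-1)%N.
  move=> b0 cb gb; have b1 : b = 1 %[mod g].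
    by apply/eqP; rewrite eqn_mod_dvd // subn1.
  have [/eqP|mb] := pm b cb b1; first by rewrite eqn_mod_dvd // subn1.
  have b2 : (b.+1 - b.-1 = 2)%N by case: (b) b0 => // b' _; rewrite subSn ?subSnn.
  have : (g %| b.+1 - b.-1)%N by rewrite dvdn_sub // (dvdn_trans gm).
  by rewrite b2 => /(dvdn_leq (isT : (0 < 2)%N)); rewrite leqNgt g2.
have [k mE] := dvdnP gm.
have k0 : (0 < k)%N by case: (k) mE => //; lia.
(* If a prime p divided k = k' p and g, then k' g + 1 would be a unit mod m that is 1 mod g, so m =
   k' p g would divide k' g. *)
have ckg : coprime k g.
  apply/negPn/negP => ncop.
  pose p := pdiv (gcdn k g).
  have pk : prime p.
    by apply: pdiv_prime; rewrite ltn_neqAle gcdn_gt0 k0 eq_sym andbT.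
  have : (p %| gcdn k g)%N by apply: pdiv_dvd.
  rewrite dvdn_gcd => /andP[/dvdnP[k' kE] pg'].
  have := pm1 (k' * g).+1; rewrite /= ltnS leq0n dvdn_mull //.
  have k'0 : (0 < k')%N.
    by rewrite lt0n; apply: contraTneq k0 => k'0; rewrite kE k'0.
  have c : coprime (k' * g).+1 m.
    have c1 : coprime (k' * g).+1 (k' * g) by apply: coprimeSn.
    move: c1; rewrite mE kE !coprimeMr => /andP[-> cg]; rewrite cg /= andbT.
    by apply: coprime_dvdr cg.
  move=> /(_ isT c isT) /dvdn_leq; rewrite muln_gt0 k'0 g0 mE kE => /(_ isT).
  by rewrite mulnAC -[leqRHS]muln1 leq_pmul2l ?muln_gt0 ?k'0 // leqNgt prime_gt1.
have [k2|k2] := leqP k 2.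
  have : k = 1%N \/ k = 2%N by lia.
  case=> kE; first by constructor 2; rewrite mE kE mul1n.
  constructor 3; exists g; split => //; last by rewrite mE kE.
  by move: ckg; rewrite kE coprime2n.
exfalso.
(* For k at least 3, a unit that is 1 mod g and -1 mod k contradicts [pm1], which forces it to be 1
   mod k. *)
pose a := chinese g k 1 k.-1.
have cgk : coprime g k by rewrite coprime_sym.
have ag : a = 1 %[mod g] by apply: chinese_modl.
have ak : a = k.-1 %[mod k] by apply: chinese_modr.
have cam : coprime a m.
  rewrite mE coprimeMr -[coprime a k]coprime_modl -[coprime a g]coprime_modl ak ag.
  by rewrite !coprime_modl coprime1n andbT coprimePn.
have a0 : (0 < a)%N.
  rewrite lt0n; apply: contraTneq cam => ->; rewrite /coprime gcd0n; lia.
have := pm1 a a0 cam; rewrite -subn1 -eqn_mod_dvd // ag eqxx => /(_ isT) ma.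
have : (k %| a - 1)%N by apply: dvdn_trans ma; rewrite mE dvdn_mulr.
rewrite -eqn_mod_dvd // ak; case: (k) k2 => [|[|[|k']]] // _.
by rewrite !modn_small.
Qed.

End Arithmetic.

(** * Rational polynomials evaluated at primitive roots of unity *)

Section RationalPolynomials.

(** Irreducibility of Phi_n over Q: a nontrivial gcd has a root in [algC], which is a primitive n-th
    root of unity, and Phi_n is the minimal polynomial of that root. *)
Lemma dvdp_Cyclotomic_rat n (p : {poly rat}) : (0 < n)%N ->
  ~~ coprimep (map_poly intr 'Phi_n) p -> map_poly intr 'Phi_n %| p.
Proof.
move=> n0; set q := map_poly intr _ => ncop.
have qC : map_poly ratr q = map_poly intr 'Phi_n :> {poly algC}.
  by rewrite -map_poly_comp; apply: eq_map_poly => a; rewrite /= rmorph_int.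
have [z zn] := C_prim_root_exists n0.
have [x xg] : exists x : algC, root (map_poly ratr (gcdp q p)) x.
  apply/closed_rootP; rewrite size_map_poly.
  by move: ncop; rewrite coprimep_def.
have xq : root (map_poly ratr q) x.
  by apply: root_dvdp xg; rewrite dvdp_map dvdp_gcdl.
have xp : root (map_poly ratr p) x.
  by apply: root_dvdp xg; rewrite dvdp_map dvdp_gcdr.
have xn : n.-primitive_root x.
  by rewrite -(root_cyclotomic zn) -(Cintr_Cyclotomic zn) -qC.
have [q' [q'E _] q'dvd] := minCpolyP x.
have -> : q = q'; last by rewrite -q'dvd.
apply: (@map_poly_inj _ algC ratr).
by rewrite /= qC (Cintr_Cyclotomic xn) -(minCpoly_cyclotomic xn).
Qed.

Variable F : numFieldType.

(** Since X^n - 1 is the product of the Phi_d with d | n, w is a root of some Phi_d; then w^d = 1,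
    so n | d and d = n. *)
Lemma root_Cyclotomic n (w : F) : n.-primitive_root w ->
  root (map_poly intr 'Phi_n) w.
Proof.
move=> wn; have n0 := prim_order_gt0 wn.
have : root (map_poly intr ('X^n - 1)) w.
  by rewrite rmorphB /= map_polyXn rmorph1 rootE !hornerE prim_expr_order ?subrr.
rewrite -prod_Cyclotomic // rmorph_prod /=.
have [_ _ dn] := divisors_correct n0.
rewrite (_ : root _ w = has (fun d => root (map_poly intr 'Phi_d) w) (divisors n)); last first.
  elim: (divisors n) => [|d s IH]; first by rewrite big_nil (negPf (root1 _)).
  by rewrite big_cons rootM IH.
move=> /hasP[d dn' wd].
have d0 : (0 < d)%N by move: dn'; rewrite dn => /dvdn_gt0; apply.
have : root (map_poly intr ('X^d - 1)) w.
  rewrite -prod_Cyclotomic // (big_rem d) -?dvdn_divisors //= rmorphM rootM.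
  by rewrite wd.
rewrite rmorphB /= map_polyXn rmorph1 rootE !hornerE subr_eq0 -(prim_order_dvd wn) => nd.
by rewrite dn in dn'; rewrite (_ : n = d) //; apply/eqP; rewrite eqn_dvd nd.
Qed.

Lemma dvdp_Cyclotomic_of_root n (p : {poly rat}) (w : F) :
  n.-primitive_root w -> root (map_poly ratr p) w ->
  map_poly intr 'Phi_n %| p.
Proof.
move=> wn pw; apply: dvdp_Cyclotomic_rat (prim_order_gt0 wn) _.
rewrite -(coprimep_map (ratr : {rmorphism rat -> F})).
apply/negP => /coprimep_root/(_ _)/negP; apply; last exact: pw.
rewrite -map_poly_comp (eq_map_poly (_ : _ =1 intr)) ?root_Cyclotomic //.
by move=> a; rewrite /= rmorph_int.
Qed.

(** This stands in for the field automorphism sending w to w'. *)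
Lemma root_prim_conjugate n (p : {poly rat}) (w w' : F) :
  n.-primitive_root w -> n.-primitive_root w' ->
  root (map_poly ratr p) w -> root (map_poly ratr p) w'.
Proof.
move=> wn wn' /(dvdp_Cyclotomic_of_root wn) dvd.
have := root_Cyclotomic wn'; apply: root_dvdp.
rewrite (eq_map_poly (_ : _ =1 (ratr : rat -> F) \o intr)).
  by rewrite map_poly_comp dvdp_map.
by move=> a; rewrite /= rmorph_int.
Qed.

(** Linear independence over Q of the powers of w with exponent below phi(n). *)
Lemma small_root_prim0 n (p : {poly rat}) (w : F) :
  n.-primitive_root w -> (size p <= totient n)%N ->
  root (map_poly ratr p) w -> p = 0.
Proof.
move=> wn sp /(dvdp_Cyclotomic_of_root wn) dvd; apply/eqP/negPn/negP => p0.
have := dvdp_leq p0 dvd.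
by rewrite size_map_inj_poly ?size_Cyclotomic ?ltnNge ?sp //; exact: intr_inj.
Qed.

(** Q[w] is a field: if p(w) is nonzero then p is coprime to Phi_n, and a Bezout relation evaluated
    at w inverts p(w). The value 0 has inverse 0 by convention. *)
Lemma ratpoly_inverse n (p : {poly rat}) (w : F) :
  n.-primitive_root w -> exists q : {poly rat},
  (map_poly ratr q).[w] = (map_poly ratr p).[w]^-1.
Proof.
move=> wn; have [pw|pw] := eqVneq (map_poly ratr p).[w] 0.
  by exists 0; rewrite rmorph0 horner0 pw invr0.
have cop : coprimep (map_poly intr 'Phi_n) p.
  apply/negPn/negP => /(dvdp_Cyclotomic_rat (prim_order_gt0 wn)) dvd.
  move/negP: pw; apply; rewrite -/(root _ w).
  have := root_Cyclotomic wn; apply: root_dvdp.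
  rewrite (eq_map_poly (_ : _ =1 (ratr : rat -> F) \o intr)).
    by rewrite map_poly_comp dvdp_map.
  by move=> a; rewrite /= rmorph_int.
have [[u v] /= uv] := Bezout_eq1_coprimepP _ _ cop.
exists v; apply: (mulIf pw); rewrite mulVf // -hornerM -rmorphM.
move/(congr1 (fun p => (map_poly ratr p).[w])): uv.
rewrite rmorphD !rmorphM rmorph1 hornerD !hornerM hornerC /=.
rewrite -map_poly_comp (eq_map_poly (_ : _ =1 intr)); last first.
  by move=> a; rewrite /= rmorph_int.
by rewrite (rootP (root_Cyclotomic wn)) mulr0 add0r.
Qed.

End RationalPolynomials.

(** * The complex numbers [zeta R n] *)

Section RootsOfUnity.
Variable R : realType.
Local Notation C := R[i].
Implicit Types n m : nat.

Lemma conjcD (x y : C) : (x + y)^*%C = x^*%C + y^*%C.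
Proof. exact: rmorphD. Qed.

Lemma conjcB (x y : C) : (x - y)^*%C = x^*%C - y^*%C.
Proof. exact: rmorphB. Qed.

Lemma conjcM (x y : C) : (x * y)^*%C = x^*%C * y^*%C.
Proof. exact: rmorphM. Qed.

Lemma conjcX (x : C) j : (x ^+ j)^*%C = x^*%C ^+ j.
Proof. exact: rmorphXn. Qed.

Definition cis (x : R) : C := cos x +i* sin x.

Lemma cisD x y : cis (x + y) = cis x * cis y.
Proof. by rewrite /cis cosD sinD; apply/eqP; rewrite eq_complex /= !eqxx /=; apply/eqP; ring. Qed.

Lemma cisX x j : cis x ^+ j = cis (j%:R * x).
Proof.
elim: j => [|j IH]; first by rewrite expr0 mul0r /cis cos0 sin0.
by rewrite exprS IH -cisD -[j.+1]add1n natrD mulrDl mul1r.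
Qed.

Lemma zetaE n : zeta R n = cis (2 * pi / n%:R). Proof. by []. Qed.

Lemma zeta_mulX d e : (0 < e)%N -> zeta R (e * d) ^+ e = zeta R d.
Proof.
move=> e0; rewrite !zetaE cisX natrM invfM; congr cis.
set v := d%:R^-1; have {}e0 : e%:R != 0 :> R by rewrite pnatr_eq0 -lt0n.
by field.
Qed.

Lemma zeta1 : zeta R 1 = 1.
Proof. by rewrite zetaE divr1 mulr_natl /cis cos2pi sin2pi. Qed.

Lemma zeta2 : zeta R 2 = -1.
Proof.
rewrite zetaE mulrAC divff ?pnatr_eq0// mul1r /cis cospi sinpi.
by apply/eqP; rewrite eq_complex /= oppr0 !eqxx.
Qed.

(** The real part is 1 - 2 sin(x/2)^2, and sin is positive at x/2. *)
Lemma cis_eq1 x : 0 < x < 2 * pi -> cis x != 1.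
Proof.
move=> /andP[x0 x2]; rewrite eq_complex /= negb_and; apply/orP; left.
have -> : x = (x / 2) *+ 2 by rewrite -mulr_natr divfK ?pnatr_eq0.
rewrite cos_mulr2n cos2sin2.
have : 0 < sin (x / 2).
  by apply: sin_gt0_pi; rewrite divr_gt0 //= ltr_pdivrMr // mulrC.
by move=> /(exprn_gt0 2); lra.
Qed.

Lemma zeta_prim n : (0 < n)%N -> n.-primitive_root (zeta R n).
Proof.
move=> n0; rewrite /primitive_root_of_unity n0 /=; apply/forallP => -[i /= ni].
rewrite unity_rootE; apply/eqP.
have [->|ne] := eqVneq i.+1 n.
  by apply/eqP; rewrite -[n in zeta R n]muln1 zeta_mulX // zeta1.
apply/negbTE; rewrite zetaE cisX; apply: cis_eq1.
have np : 0 < n%:R :> R by rewrite ltr0n.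
have twopi : 0 < 2 * pi :> R by rewrite mulr_gt0 ?pi_gt0.
rewrite [X in 0 < X < _](_ : _ = 2 * pi * (i.+1%:R / n%:R)); last by field; lra.
rewrite pmulr_rgt0 // divr_gt0 ?ltr0n //= gtr_pMr // ltr_pdivrMr // mul1r ltr_nat.
by rewrite ltn_neqAle ne ni.
Qed.

Lemma normcis x : cis x * (cis x)^*%C = 1.
Proof.
apply/eqP; rewrite eq_complex /=; apply/andP; split; apply/eqP.
  by rewrite -[RHS](cos2Dsin2 x); ring.
by ring.
Qed.

Lemma conj_zeta n : (zeta R n)^*%C = (zeta R n)^-1.
Proof.
have h := normcis (2 * pi / n%:R); rewrite -zetaE in h.
have z0 : zeta R n != 0.
  by apply/eqP => z0; move: h; rewrite z0 mul0r => /esym/eqP; rewrite oner_eq0.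
by apply: (mulfI z0); rewrite h divff.
Qed.

Lemma Im_zeta_gt0 n : (3 <= n)%N -> 0 < complex.Im (zeta R n).
Proof.
move=> n3; rewrite /=; apply: sin_gt0_pi; have pi0 := pi_gt0 R.
have np : 0 < n%:R :> R by rewrite ltr0n; lia.
rewrite divr_gt0 ?mulr_gt0 //= ltr_pdivrMr // mulrC ltr_pM2l //.
by rewrite ltr_nat.
Qed.

(** The d-th power of zeta_2d is -1, so zeta_2d = - zeta_2d^(d+1), where the exponent d + 1 is even
    and zeta_2d^2 = zeta_d. *)
Lemma zeta_double d : odd d -> zeta R (2 * d) = - zeta R d ^+ (d.+1./2).
Proof.
move=> d_odd; have d0 : (0 < d)%N by case: d d_odd.
rewrite -[zeta R d in RHS](@zeta_mulX d 2) // -exprM.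
have -> : (2 * d.+1./2 = d.+1)%N by lia.
by rewrite exprS mulnC zeta_mulX // zeta2 mulrN1 opprK.
Qed.

Lemma zeta_neq0 n : zeta R n != 0.
Proof.
apply/eqP => z0; have := normcis (2 * pi / n%:R).
by rewrite -zetaE z0 mul0r => /esym/eqP; rewrite oner_eq0.
Qed.

End RootsOfUnity.

(** * Generated subfields and subrings *)

Section Adjunction.
Variable R : realType.
Local Notation C := R[i].
Implicit Types (x y z : C) (F : set C).

Lemma Qadjoin_divring_closed x : GRing.divring_closed (mem (Qadjoin x)).
Proof.
split => [|a b|a b]; rewrite ?inE /Qadjoin.
- by move=> F [[F1 _ _] _]; move: F1; rewrite inE.
- move=> aQ bQ F FQ; have [[_ FB _] _] := FQ.
  by have := FB a b; rewrite !inE; apply; [apply: aQ|apply: bQ].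
- move=> aQ bQ F FQ; have [[_ _ FB] _] := FQ.
  by have := FB a b; rewrite !inE; apply; [apply: aQ|apply: bQ].
Qed.

Lemma Zadjoin_subring_closed x : GRing.subring_closed (mem (Zadjoin x)).
Proof.
split => [|a b|a b]; rewrite ?inE /Zadjoin.
- by move=> F [[F1 _ _] _]; move: F1; rewrite inE.
- move=> aQ bQ F FQ; have [[_ FB _] _] := FQ.
  by have := FB a b; rewrite !inE; apply; [apply: aQ|apply: bQ].
- move=> aQ bQ F FQ; have [[_ _ FB] _] := FQ.
  by have := FB a b; rewrite !inE; apply; [apply: aQ|apply: bQ].
Qed.

(** Named predicates that carry the closure instances, so that the [rpred] lemmas apply to generated
    fields and rings. *)
Definition Qpred x : {pred C} := mem (Qadjoin x).
Definition Zpred x : {pred C} := mem (Zadjoin x).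

HB.instance Definition _ x := GRing.isDivringClosed.Build C (Qpred x) (Qadjoin_divring_closed x).
HB.instance Definition _ x := GRing.isSubringClosed.Build C (Zpred x) (Zadjoin_subring_closed x).

Lemma Qpred_gen x : x \in Qpred x.
Proof. by rewrite inE /=; apply: sub_gen_smallest. Qed.

Lemma Zpred_gen x : x \in Zpred x.
Proof. by rewrite inE /=; apply: sub_gen_smallest. Qed.

Lemma QpredP x z : reflect (Qadjoin x z) (z \in Qpred x).
Proof. by apply: (iffP idP); rewrite inE. Qed.

Lemma ZpredP x z : reflect (Zadjoin x z) (z \in Zpred x).
Proof. by apply: (iffP idP); rewrite inE. Qed.

Lemma Qadjoin_sub x (S : divringClosed C) : x \in S -> Qadjoin x `<=` [set` S].
Proof.
move=> xS; apply: smallest_sub => [|_ -> //].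
by split => [|a b|a b]; rewrite !inE /= ?rpred1 //; [apply: rpredB | apply: rpred_div].
Qed.

Lemma Zadjoin_sub x (S : subringClosed C) : x \in S -> Zadjoin x `<=` [set` S].
Proof.
move=> xS; apply: smallest_sub => [|_ -> //].
by split => [|a b|a b]; rewrite !inE /= ?rpred1 //; [apply: rpredB | apply: rpredM].
Qed.

Lemma Qadjoin_subset x y : x \in Qpred y -> Qadjoin x `<=` Qadjoin y.
Proof. by move=> /Qadjoin_sub h z /h/QpredP. Qed.

Lemma Zadjoin_subset x y : x \in Zpred y -> Zadjoin x `<=` Zadjoin y.
Proof. by move=> /Zadjoin_sub h z /h/ZpredP. Qed.

Lemma Zpred_Qpred x z : z \in Zpred x -> z \in Qpred x.
Proof. by move/ZpredP/(Zadjoin_sub (Qpred_gen x)). Qed.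

End Adjunction.

(** * Inclusions between cyclotomic fields, their real subfields and their rings *)

Section CyclotomicFields.
Variable R : realType.
Local Notation C := R[i].
Implicit Types (n m : nat) (x z : C).

(** By [ratpoly_inverse], Q[zeta_n] is already a field, so it contains the field generated by
    zeta_n. *)
Lemma Kfield_ratpoly n z : (0 < n)%N -> Kfield R n z ->
  exists p : {poly rat}, z = (map_poly ratr p).[zeta R n].
Proof.
move=> n0; move: z; apply: smallest_sub; last first.
  by move=> _ ->; exists 'X; rewrite map_polyX hornerX.
split => [|a b|a b]; rewrite !inE /=.
- by exists 1; rewrite rmorph1 hornerC.
- by move=> [p ->] [q ->]; exists (p - q); rewrite rmorphB hornerD hornerN.
- move=> [p ->] [q ->]; have [q' q'E] := ratpoly_inverse q (zeta_prim R n0).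
  by exists (p * q'); rewrite rmorphM hornerM; congr (_ * _); apply/esym.
Qed.

Lemma kfield_real n z : kfield R n z -> z^*%C = z.
Proof.
move: z; apply: smallest_sub; last first.
  by move=> _ ->; rewrite /mkset conjcD conjcK addrC.
split => [|a b|a b]; rewrite !inE /=.
- exact: conjc1.
- by move=> aE bE; rewrite conjcB aE bE.
- by move=> aE bE; rewrite conjcM aE conjc_inv bE.
Qed.

Lemma kfield_gen n : kfield R n (zeta R n + (zeta R n)^*%C).
Proof. by apply/QpredP; apply: Qpred_gen. Qed.

Lemma oring_gen n : oring R n (zeta R n + (zeta R n)^*%C).
Proof. by apply/ZpredP; apply: Zpred_gen. Qed.

Lemma Oring_gen n : Oring R n (zeta R n).
Proof. by apply/ZpredP; apply: Zpred_gen. Qed.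

(** K_n has degree at most 2 over k_n: the sums a + b zeta_n are shown to form a field. *)
Lemma Kfield_quadratic n z : (0 < n)%N -> Kfield R n z ->
  exists a b, [/\ kfield R n a, kfield R n b & z = a + b * zeta R n].
Proof.
set t := zeta R n + (zeta R n)^*%C.
have k0 := zeta_neq0 R n.
have tE : t = zeta R n + (zeta R n)^-1 by rewrite /t conj_zeta.
move=> n0; move: z; apply: smallest_sub; last first.
  move=> _ ->; exists 0, 1; rewrite add0r mul1r.
  by split=> //; apply/QpredP; rewrite ?rpred0 ?rpred1.
split => [|z w|z w]; rewrite !inE /=.
- exists 1, 0; rewrite mul0r addr0.
  by split=> //; apply/QpredP; rewrite ?rpred0 ?rpred1.
- move=> [a [b [/QpredP ak /QpredP bk ->]]] [c [d [/QpredP ck /QpredP dk ->]]].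
  exists (a - c), (b - d); split; [apply/QpredP; exact: rpredB | apply/QpredP; exact: rpredB |].
  by ring.
- move=> [a [b [/QpredP ak /QpredP bk ->]]] [c [d [/QpredP ck /QpredP dk ->]]].
  have tk : t \in Qpred t by apply: Qpred_gen.
  have [->|w0] := eqVneq (c + d * zeta R n) 0.
    exists 0, 0; rewrite invr0 mulr0 mul0r addr0.
    by split=> //; apply/QpredP; rewrite ?rpred0.
  (* N is the product of the divisor c + d zeta_n with its complex conjugate. It lies in k_n, so the
     quotient is the numerator times that conjugate, divided by N. *)
  pose N := c * c + c * d * t + d * d.
  have NE : N = (c + d * zeta R n) * (c + d * (zeta R n)^*%C).
    have quadN (F : fieldType) (u v x : F) : x != 0 ->
      u * u + u * v * (x + x^-1) + v * v = (u + v * x) * (u + v * x^-1).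
      by move=> ?; field.
    by rewrite /N tE conj_zeta quadN.
  have N0 : N != 0.
    rewrite NE mulf_neq0 //; apply: contra_neq w0 => w0.
    rewrite -[c + _]conjcK conjcD conjcM.
    rewrite (kfield_real (elimT (QpredP _ _) ck)).
    by rewrite (kfield_real (elimT (QpredP _ _) dk)) w0 conjc0.
  have Nk : N \in Qpred t by rewrite /N !rpredD ?rpredM.
  exists ((a * c + a * d * t + b * d) / N), ((b * c - a * d) / N).
  split; [apply/QpredP | apply/QpredP |].
  + by rewrite rpred_div // !rpredD ?rpredM.
  + by rewrite rpred_div // rpredB ?rpredM.
  apply: (mulIf w0); rewrite divfK //.
  have quadV (F : fieldType) (x u v u' v' : F) (T := x + x^-1)
      (D := u' * u' + u' * v' * T + v' * v') : x != 0 -> D != 0 ->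
    u + v * x = ((u * u' + u * v' * T + v * v') / D + (v * u' - u * v') / D * x)
      * (u' + v' * x).
    rewrite /D /T => x0 D0; field; rewrite x0 /=.
    by move: (mulf_neq0 x0 D0); congr (_ != 0); field.
  have NE' : N = c * c + c * d * (zeta R n + (zeta R n)^-1) + d * d by rewrite -tE.
  by move: N0; rewrite NE' tE; apply: quadV.
Qed.

(** In z = a + b zeta_n the coefficients are real, while zeta_n is not for n >= 3; invariance under
    conjugation forces b = 0. *)
Lemma Kfield_real_kfield n z : (3 <= n)%N ->
  Kfield R n z -> z^*%C = z -> kfield R n z.
Proof.
move=> n3 zK; have n0 : (0 < n)%N by lia.
have [a [b [ak bk ->]]] := Kfield_quadratic n0 zK.
rewrite conjcD conjcM (kfield_real ak) (kfield_real bk).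
move=> /addrI /eqP; rewrite -subr_eq0 -mulrBr mulf_eq0 => /orP[/eqP ->|].
  by rewrite mul0r addr0.
have := Im_zeta_gt0 R n3; case: (zeta R n) => u v /= v0.
by rewrite eq_complex /= => /andP[_ /eqP]; lra.
Qed.

Lemma kfield_sub_Kfield n : kfield R n `<=` Kfield R n.
Proof.
apply: Qadjoin_subset; rewrite conj_zeta.
have z := Qpred_gen (zeta R n).
by rewrite rpredD // rpredV.
Qed.

(** The difference of the two sums, times x y, factors as (x - y)(x y - 1). The second factor is
    where the residue -1 mod m comes from. *)
Lemma addrV_eq (F : fieldType) (x y : F) : x != 0 -> y != 0 ->
  x + x^-1 = y + y^-1 -> x = y \/ x * y = 1.
Proof.
move=> x0 y0 h; have /eqP : (x - y) * (x * y - 1) = 0.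
  have -> : (x - y) * (x * y - 1) = (x + x^-1 - (y + y^-1)) * (x * y).
    by field; rewrite x0 y0.
  by rewrite h subrr mul0r.
by rewrite mulf_eq0 !subr_eq0 => /orP[] /eqP; [left|right].
Qed.

(* A unit b mod mn acts on Q(zeta_mn) by raising zeta_mn to the b-th power; if
   b = 1 mod n it fixes K_n, hence zeta_m + zeta_m^-1, so b = +-1 mod m. *)
Lemma kfield_sub_dvd m n : (3 <= m)%N -> (3 <= n)%N ->
  kfield R m `<=` kfield R n ->
  [\/ m \in [:: 3; 4; 6]%N, (m %| n)%N |
         exists d : nat, [/\ odd d, (d %| n)%N & m = (2 * d)%N]].
Proof.
move=> m3 n3 sub; apply: dvdn_of_units_pm1 => // b bm bn b1.
have m0 : (0 < m)%N by lia.
have n0 : (0 < n)%N by lia.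
have mn0 : (0 < m * n)%N by rewrite muln_gt0 m0.
set w := zeta R (m * n).
have wp : (m * n).-primitive_root w by apply: zeta_prim.
have wm : w ^+ m = zeta R n by apply: zeta_mulX.
have wn : w ^+ n = zeta R m by rewrite /w mulnC zeta_mulX.
have /(Kfield_ratpoly n0)[P PE] : Kfield R n (zeta R m + (zeta R m)^*%C).
  by apply: kfield_sub_Kfield; apply: sub; apply: kfield_gen.
(* As w^n = zeta_m and w^m = zeta_n, Q(w) = 0 encodes zeta_m + zeta_m^-1 = P(zeta_n); the exponent n
   (m - 1) expresses the inverse by a nonnegative power. *)
pose Q : {poly rat} := 'X^n + 'X^(n * m.-1) - (P \Po 'X^m).
have QE x : (map_poly ratr Q).[x] =
    x ^+ n + x ^+ (n * m.-1) - (map_poly ratr P).[x ^+ m] :> C.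
  rewrite /Q rmorphB rmorphD /= !map_polyXn map_comp_poly map_polyXn.
  by rewrite !(hornerE, horner_comp).
have xV (x : C) : x ^+ (n * m) = 1 -> x ^+ (n * m.-1) = (x ^+ n)^-1.
  move=> x1; have xn0 : x ^+ n != 0.
    apply/eqP => x0; move/eqP: x1; rewrite exprM x0 expr0n.
    by rewrite eqn0Ngt m0 eq_sym oner_eq0.
  by apply: (mulfI xn0); rewrite divff // exprM -exprS prednK // -exprM.
have wnm : w ^+ (n * m) = 1 by rewrite mulnC; apply: prim_expr_order.
have wbp : (m * n).-primitive_root (w ^+ b).
  by rewrite prim_root_exp_coprime // coprimeMr bm.
have Qw : root (map_poly ratr Q) w.
  by rewrite /root QE xV // wm wn -PE conj_zeta subrr.
(* At w^b the value P(zeta_n^b) is still P(zeta_n), because b is 1 mod n; hence zeta_m^b and zeta_m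
   have the same sum with their inverses. *)
have := root_prim_conjugate wp wbp Qw.
have zb : zeta R n ^+ b = zeta R n.
  by rewrite -[RHS]expr1; apply/eqP; rewrite (eq_prim_root_expr (zeta_prim R n0)) b1.
rewrite /root QE xV; last by rewrite -exprM mulnC exprM wnm expr1n.
rewrite -!exprM ![(b * _)%N]mulnC !exprM wm wn zb -PE conj_zeta subr_eq0 => /eqP.
case/addrV_eq; rewrite ?expf_neq0 ?zeta_neq0 //.
  move/eqP; rewrite -[X in _ == X]expr1 (eq_prim_root_expr (zeta_prim R m0)) => /eqP.
  by left.
by move/eqP; rewrite -exprSr -(prim_order_dvd (zeta_prim R m0)); right.
Qed.

Lemma zeta_dvd_power m n : (0 < n)%N -> (m %| n)%N ->
  exists j, zeta R m = zeta R n ^+ j.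
Proof.
move=> n0 /dvdnP[e nE]; exists e; rewrite nE zeta_mulX //.
by case: e nE => // nE; move: n0; rewrite nE.
Qed.

(* Up to sign, zeta_m is a power of zeta_n. *)
Lemma zeta_signed_power m n : (0 < n)%N ->
  (m %| n)%N \/ (exists d : nat, [/\ odd d, (d %| n)%N & m = (2 * d)%N]) ->
  exists (s : bool) j, zeta R m = (-1) ^+ s * zeta R n ^+ j.
Proof.
move=> n0 [/(zeta_dvd_power n0)[j ->]|[d [d_odd /(zeta_dvd_power n0)[j jE] ->]]].
  by exists false, j; rewrite mul1r.
by exists true, (j * d.+1./2)%N; rewrite zeta_double // jE mulN1r exprM.
Qed.

(** Chebyshev recursion: each sum is the preceding one times x + x^-1, minus the one before, so the
    induction carries two consecutive indices. *)
Lemma exprV_sum_Zpred x j : x != 0 -> x ^+ j + (x ^+ j)^-1 \in Zpred (x + x^-1).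
Proof.
move=> x0; pose P j := x ^+ j + (x ^+ j)^-1 \in Zpred (x + x^-1).
suff : P j /\ P j.+1 by case.
elim: j => [|j [Pj Pj1]]; rewrite /P.
  by rewrite expr0 expr1 invr1 rpredD ?rpred1 ?Zpred_gen.
split=> //.
have -> : x ^+ j.+2 + (x ^+ j.+2)^-1 =
    (x ^+ j.+1 + (x ^+ j.+1)^-1) * (x + x^-1) - (x ^+ j + (x ^+ j)^-1).
  by rewrite !exprS; field; rewrite x0 expf_neq0.
by rewrite rpredB // rpredM // Zpred_gen.
Qed.

Lemma zeta3_sum : zeta R 3 + (zeta R 3)^-1 = -1.
Proof.
have p := zeta_prim R (isT : (0 < 3)%N); have := prim_expr_order p.
have z0 := zeta_neq0 R 3.
have /eqP z1 : zeta R 3 != 1.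
  by rewrite -[X in X != _]expr1 -(prim_order_dvd p).
move=> /eqP; rewrite -subr_eq0.
have -> : zeta R 3 ^+ 3 - 1 = (zeta R 3 - 1) * (zeta R 3 + (zeta R 3)^-1 + 1) * zeta R 3.
  by field.
rewrite !mulf_eq0 (negPf z0) orbF subr_eq0 => /orP[/eqP //|].
by rewrite addr_eq0 => /eqP.
Qed.

(** The sums for 3, 4 and 6 are the integers -1, 0 and 1. *)
Lemma zeta346_sum m x : m \in [:: 3; 4; 6]%N ->
  zeta R m + (zeta R m)^*%C \in Zpred x.
Proof.
rewrite conj_zeta => hm; have /or3P[] : [|| m == 3, m == 4 | m == 6]%N.
  by move: hm; rewrite !inE.
all: move=> /eqP ->.
- by rewrite zeta3_sum rpredN1.
- have z2 : zeta R 4 ^+ 2 = -1 by rewrite (@zeta_mulX R 2 2) // zeta2.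
  have z0 := zeta_neq0 R 4.
  have -> : zeta R 4 + (zeta R 4)^-1 = (zeta R 4 ^+ 2 + 1) / zeta R 4 by field.
  by rewrite z2 addNr mul0r rpred0.
- have z0 := zeta_neq0 R 3.
  rewrite (@zeta_double R 3) //= (_ : _ + _ = 2 - (zeta R 3 + (zeta R 3)^-1) ^+ 2).
    by rewrite zeta3_sum sqrrN expr1n rpredB ?rpred_nat ?rpred1.
  by rewrite invrN; field.
Qed.

Lemma oring_subset m n : (0 < n)%N ->
  [\/ m \in [:: 3; 4; 6]%N, (m %| n)%N |
         exists d : nat, [/\ odd d, (d %| n)%N & m = (2 * d)%N]] ->
  oring R m `<=` oring R n.
Proof.
move=> n0 h; apply: Zadjoin_subset.
have {h}[|h] : m \in [:: 3; 4; 6]%N \/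
    ((m %| n)%N \/ (exists d : nat, [/\ odd d, (d %| n)%N & m = (2 * d)%N])).
- by case: h; tauto.
- exact: zeta346_sum.
have [s [j ->]] := zeta_signed_power n0 h.
have -> : ((-1) ^+ s * zeta R n ^+ j)^*%C = (-1) ^+ s * (zeta R n ^+ j)^-1.
  by rewrite conjcM !conjcX conj_zeta exprVn [in LHS](rmorphN1 (@conjc R)).
rewrite -mulrDr rpredM ?rpred_sign // conj_zeta exprV_sum_Zpred ?zeta_neq0 //.
Qed.

Lemma Oring_subset m n : (0 < n)%N ->
  [\/ m \in [:: 3; 4; 6]%N, (m %| n)%N |
         exists d : nat, [/\ odd d, (d %| n)%N & m = (2 * d)%N]] ->
  m \in [:: 3; 4; 6]%N \/ Oring R m `<=` Oring R n.
Proof.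
move=> n0 h; have {h}[|h] : m \in [:: 3; 4; 6]%N \/
    ((m %| n)%N \/ (exists d : nat, [/\ odd d, (d %| n)%N & m = (2 * d)%N])).
- by case: h; tauto.
- by left.
right; apply: Zadjoin_subset; have [s [j ->]] := zeta_signed_power n0 h.
by rewrite rpredM ?rpred_sign // rpredX // Zpred_gen.
Qed.

Lemma Kfield_of_Oring m n : Oring R m `<=` Oring R n -> Kfield R m `<=` Kfield R n.
Proof.
move=> sub; apply: Qadjoin_subset; apply: Zpred_Qpred; apply/ZpredP.
by apply: sub; apply: Oring_gen.
Qed.

Lemma kfield_of_Kfield m n : (3 <= n)%N ->
  m \in [:: 3; 4; 6]%N \/ Kfield R m `<=` Kfield R n -> kfield R m `<=` kfield R n.
Proof.
move=> n3 [m346|sub]; apply: Qadjoin_subset.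
  by apply: Zpred_Qpred; apply: zeta346_sum.
suff /QpredP : kfield R n (zeta R m + (zeta R m)^*%C) by [].
apply: Kfield_real_kfield => //; last by rewrite conjcD conjcK addrC.
by apply: sub; apply: kfield_sub_Kfield; apply: kfield_gen.
Qed.

End CyclotomicFields.

(** * Convex hulls, extreme points and affine images *)

Section Polygons.
Variable R : realType.
Local Notation C := R[i].
Implicit Types (A B P : set C) (x y z : C) (t : R).

Lemma convex_setP B : @convex_set R (Rcomplex R) B <->
  forall y z t, B y -> B z -> 0 < t < 1 -> B ((1 - t)%:C * y + t%:C * z).
Proof.
have convE (k : {i01 R}) y z :
    @conv R (convex_lmodType (Rcomplex R)) k z y = (1 - k%:num)%:C * y + k%:num%:C * z.
  rewrite /conv /=; case: y z => [y1 y2] [z1 z2]; apply/eqP.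
  by rewrite eq_complex /=; apply/andP; split; apply/eqP; rewrite /unstable.onem; ring.
split=> cB; [move/convex_setW: cB => cB | apply/convex_setW].
  move=> y z t By Bz /andP[t0 t1].
  pose k : {i01 R} := Itv01 (ltW t0) (ltW t1).
  have := cB z y; rewrite !inE => /(_ Bz By k t0 t1).
  by rewrite convE inE.
move=> z y; rewrite !inE => Bz By k k0 k1.
by rewrite convE inE; apply: cB => //; rewrite k0.
Qed.

Lemma conv_hull_convex A y z t :
  conv_hull A y -> conv_hull A z -> 0 < t < 1 ->
  conv_hull A ((1 - t)%:C * y + t%:C * z).
Proof.
move=> Ay Az t01 B [cB AB]; move/convex_setP: (cB); apply => //.
  exact: Ay.
exact: Az.
Qed.

Lemma conv_hull_sub A B : (forall y z t, B y -> B z -> 0 < t < 1 ->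
    B ((1 - t)%:C * y + t%:C * z)) -> A `<=` B -> conv_hull A `<=` B.
Proof. by move=> /convex_setP cB AB; apply: smallest_sub. Qed.

(** Removing an extreme point from the hull leaves a convex set; if the point were not in A, that
    smaller set would still contain A. *)
Lemma vertices_conv_hull_sub A : vertices (conv_hull A) `<=` A.
Proof.
move=> x [xA xext]; apply: contrapT => nAx.
suff /(_ _ xA)[_] : conv_hull A `<=` [set y | conv_hull A y /\ y <> x] by [].
apply: conv_hull_sub => [y z t [Ay yx] [Az zx] t01|y Ay].
  split; first exact: conv_hull_convex.
  move=> /esym e; have yz := xext y z t Ay Az t01 e.
  by apply: yx; rewrite e yz -mulrDl -rmorphD subrK mul1r.
by split; [exact: sub_gen_smallest | move=> yx; apply: nAx; rewrite -yx].
Qed.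

(** Here d is the square of the radius. *)
Definition disk (c : C) (d : R) : set C :=
  [set z | complex.Re (z - c) ^+ 2 + complex.Im (z - c) ^+ 2 <= d].

(** The last term measures strict convexity of squaring: it gives convexity of disks and extremality
    of points on a circle. *)
Lemma sqr_combination t (a b : R) : ((1 - t) * a + t * b) ^+ 2 =
  (1 - t) * a ^+ 2 + t * b ^+ 2 - t * (1 - t) * (a - b) ^+ 2.
Proof. by ring. Qed.

Lemma combination_sub c y z t : (1 - t)%:C * y + t%:C * z - c =
  ((1 - t) * complex.Re (y - c) + t * complex.Re (z - c)) +i*
  ((1 - t) * complex.Im (y - c) + t * complex.Im (z - c)).
Proof.
case: y z c => [y1 y2] [z1 z2] [c1 c2] /=; apply/eqP.
by rewrite eq_complex /=; apply/andP; split; apply/eqP; ring.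
Qed.

Lemma disk_convex c d y z t : disk c d y -> disk c d z -> 0 < t < 1 ->
  disk c d ((1 - t)%:C * y + t%:C * z).
Proof.
rewrite /disk /= combination_sub /= => yd zd /andP[t0 t1].
rewrite !sqr_combination.
set a := complex.Re (y - c) in yd *; set b := complex.Im (y - c) in yd *.
set a' := complex.Re (z - c) in zd *; set b' := complex.Im (z - c) in zd *.
have h : 0 <= t * (1 - t) * ((a - a') ^+ 2 + (b - b') ^+ 2).
  by rewrite mulr_ge0 ?addr_ge0 ?sqr_ge0 // mulr_ge0; lra.
have h1 : (1 - t) * (a ^+ 2 + b ^+ 2) <= (1 - t) * d by rewrite ler_wpM2l; lra.
have h2 : t * (a' ^+ 2 + b' ^+ 2) <= t * d by rewrite ler_wpM2l; lra.
lra.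
Qed.

(** The hull lies in the disk. If a point of the circle is a proper combination of y and z in the
    disk, the defect t (1 - t) |y - z|^2 cannot be positive, so y = z. *)
Lemma vertices_conv_hull_circle A c d :
  (forall x, A x -> complex.Re (x - c) ^+ 2 + complex.Im (x - c) ^+ 2 = d) ->
  vertices (conv_hull A) = A.
Proof.
move=> Acirc; apply/seteqP; split; first exact: vertices_conv_hull_sub.
move=> x Ax; split => [|y z t yA zA /andP[t0 t1] xE].
  exact: sub_gen_smallest.
have sub : conv_hull A `<=` disk c d.
  by apply: conv_hull_sub => [|w /Acirc]; [exact: disk_convex | rewrite /disk /= => ->].
have := Acirc x Ax; rewrite xE combination_sub /= !sqr_combination.
have := sub y yA; have := sub z zA; rewrite /disk /=.
set a := complex.Re (y - c); set b := complex.Im (y - c).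
set a' := complex.Re (z - c); set b' := complex.Im (z - c) => zd yd eqd.
have h1 : (1 - t) * (a ^+ 2 + b ^+ 2) <= (1 - t) * d by rewrite ler_wpM2l; lra.
have h2 : t * (a' ^+ 2 + b' ^+ 2) <= t * d by rewrite ler_wpM2l; lra.
have h : t * (1 - t) * ((a - a') ^+ 2 + (b - b') ^+ 2) <= 0 by lra.
have tt : 0 < t * (1 - t) by rewrite mulr_gt0; lra.
rewrite pmulr_rle0 // in h.
have /andP[/eqP ha /eqP hb] : ((a - a') ^+ 2 == 0) && ((b - b') ^+ 2 == 0).
  by rewrite -paddr_eq0 ?sqr_ge0 // eq_le h addr_ge0 ?sqr_ge0.
move/eqP: ha; move/eqP: hb; rewrite !sqrf_eq0 !subr_eq0 => /eqP hb /eqP ha.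
apply: (addIr (- c)); apply/eqP; rewrite eq_complex.
by rewrite -/a -/b -/a' -/b' ha hb !eqxx.
Qed.

Definition column (M : 'M[R]_2) (j : 'I_2) : C := M 0 j +i* M 1 j.

Lemma affine_mapE (M : 'M[R]_2) s z : affine_map M s z =
  (complex.Re z)%:C * column M 0 + (complex.Im z)%:C * column M 1 + s.
Proof.
rewrite /affine_map /column /=; congr (_ + _); rewrite !mxE.
rewrite !big_ord_recl !big_ord0 !mxE /= !addr0.
apply/eqP; rewrite eq_complex /= !mul0r !subr0 !addr0.
have -> : lift ord0 ord0 = 1 :> 'I_2 by apply: val_inj.
by apply/andP; split; apply/eqP; ring.
Qed.

Lemma affine_map_combination (M : 'M[R]_2) s y z t :
  affine_map M s ((1 - t)%:C * y + t%:C * z) =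
  (1 - t)%:C * affine_map M s y + t%:C * affine_map M s z.
Proof.
rewrite !affine_mapE; move: (column M 0) (column M 1) => p q.
case: y z p q s => [y1 y2] [z1 z2] [p1 p2] [q1 q2] [s1 s2].
apply/eqP; rewrite eq_complex /=; apply/andP; split; apply/eqP; ring.
Qed.

Lemma affine_map_inj (M : 'M[R]_2) s : M \in unitmx -> injective (affine_map M s).
Proof.
move=> Mu y z; rewrite /affine_map => /addIr [].
set u := M *m _; set v := M *m _ => e0 e1.
have uv : u = v.
  apply/matrixP => i j; rewrite ord1.
  have [->|->] // : i = 0 \/ i = 1.
  by case: i => -[|[|?]] // hi; [left|right]; apply: val_inj.
move: (congr1 (mulmx (invmx M)) uv); rewrite !mulKmx // => w.
apply/eqP; rewrite eq_complex; apply/andP; split; apply/eqP.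
  by move/matrixP: w => /(_ 0 0); rewrite !mxE.
by move/matrixP: w => /(_ 1 0); rewrite !mxE.
Qed.

Section AffineImage.
Variables (f : C -> C) (f_inj : injective f).
Hypothesis fC : forall y z t,
  f ((1 - t)%:C * y + t%:C * z) = (1 - t)%:C * f y + t%:C * f z.

Lemma vertices_image P : vertices (f @` P) = f @` vertices P.
Proof.
apply/seteqP; split => [x [[x' Px' <-] xext]|x [x' [Px' xext] <-]].
  exists x' => //; split=> // y z t Py Pz t01 x'E.
  by apply: f_inj; apply: (xext _ _ t) => //; rewrite ?x'E ?fC //.
split; first by exists x'.
move=> _ _ t [y Py <-] [z Pz <-] t01; rewrite -fC => /f_inj /(xext y z t Py Pz t01).
by move->.
Qed.

Lemma conv_hull_image A : f @` conv_hull A = conv_hull (f @` A).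
Proof.
apply/seteqP; split => [_ [x Ax <-]|].
  suff /(_ x Ax) : conv_hull A `<=` [set y | conv_hull (f @` A) (f y)] by [].
  apply: conv_hull_sub => [y z t hy hz t01|y Ay] /=.
    by rewrite fC; apply: conv_hull_convex.
  by apply: sub_gen_smallest; exists y.
apply: conv_hull_sub => [_ _ t [y Ay <-] [z Az <-] t01|_ [x Ax <-]].
  by exists ((1 - t)%:C * y + t%:C * z); rewrite ?fC //; apply: conv_hull_convex.
by exists x => //; apply: sub_gen_smallest.
Qed.

End AffineImage.

Definition regular_points (k : nat) (c r : C) : set C :=
  [set c + r * zeta R k ^+ (val j) | j in [set: 'I_k]].

Lemma vertices_regular k c r :
  vertices (conv_hull (regular_points k c r)) = regular_points k c r.
Proof.
apply: (@vertices_conv_hull_circle _ c (complex.Re r ^+ 2 + complex.Im r ^+ 2)).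
move=> _ [j _ <-]; rewrite [c + _ - c]addrC addKr zetaE cisX /cis.
move: (_ * (_ / _)) => x; case: r => a b /=.
by rewrite -[RHS]mulr1 -(cos2Dsin2 x); ring.
Qed.

Lemma card_regular_points k c r : (0 < k)%N -> r != 0 ->
  (regular_points k c r #= `I_k)%card.
Proof.
move=> k0 r0; rewrite (card_eqr card_II) inj_card_eq // => i j _ _ /addrI /(mulfI r0) /eqP.
rewrite (eq_prim_root_expr (zeta_prim R k0)) !modn_small ?ltn_ord // => /eqP ij.
exact: val_inj.
Qed.

Lemma regular_pointsX k c r j : (0 < k)%N -> regular_points k c r (c + r * zeta R k ^+ j).
Proof.
move=> k0; exists (Ordinal (ltn_pmod j k0)) => //=.
by rewrite prim_expr_mod // zeta_prim.
Qed.

(** The underlying regular polygon comes with some k of its own; counting vertices through the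
    injective affine map gives k = m. *)
Lemma affinely_regular_gon_vertices m P : is_affinely_regular_gon m P ->
  exists (M : 'M[R]_2) (s c r : C), [/\ M \in unitmx, r != 0 &
    vertices P = affine_map M s @` regular_points m c r].
Proof.
move=> [[M [s [Q [Mu [k [c [r [k3 r0 ->]]]] ->]]]]].
have fC := affine_map_combination M s; have finj := @affine_map_inj M s Mu.
rewrite (vertices_image finj fC) vertices_regular => card_m.
suff <- : k = m by exists M, s, c, r.
apply/(@card_eq_II k m); rewrite -(card_eqr card_m).
rewrite card_eq_sym (card_eql (inj_card_eq (in2W finj))).
by apply: card_regular_points => //; lia.
Qed.

Lemma affine_image_regular_gon m (M : 'M[R]_2) s (L : set C) : (3 <= m)%N -> M \in unitmx ->
  (forall j : nat, L (affine_map M s (zeta R m ^+ j))) ->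
  exists P, is_affinely_regular_gon m P /\ is_polygon_in L P.
Proof.
move=> m3 Mu ML; pose S := regular_points m 0 1.
have fC := affine_map_combination M s; have finj := @affine_map_inj M s Mu.
have r0 : (1 : C) != 0 by apply: oner_neq0.
have vP : vertices (affine_map M s @` conv_hull S) = affine_map M s @` S.
  by rewrite (vertices_image finj fC) vertices_regular.
exists (affine_map M s @` conv_hull S); split; split.
- by exists M, s, (conv_hull S); split => //; exists m, 0, 1.
- rewrite vP (card_eql (inj_card_eq (in2W finj))).
  by apply: card_regular_points => //; lia.
- exists (affine_map M s @` S); last exact: conv_hull_image.
  by apply: finite_image; apply: finite_image; apply: finite_finset.
- by rewrite vP => _ [_ [j _ <-] <-]; rewrite add0r mul1r.
Qed.

Lemma affine_map_parallel (M : 'M[R]_2) s x y z w (a : R) :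
  x - y = a%:C * (z - w) ->
  affine_map M s x - affine_map M s y = a%:C * (affine_map M s z - affine_map M s w).
Proof.
move=> h; have {h} -> : x = a%:C * (z - w) + y by rewrite -h subrK.
rewrite !affine_mapE; move: (column M 0) (column M 1) => p q.
case: y z w p q s => [y1 y2] [z1 z2] [w1 w2] [p1 p2] [q1 q2] [s1 s2].
apply/eqP; rewrite eq_complex /=; apply/andP; split; apply/eqP; ring.
Qed.

(* In a regular m-gon the diagonal from vertex -1 to vertex 2 is parallel to the
   edge from 0 to 1, with ratio 1 + zeta_m + zeta_m^-1; affine maps keep it. *)
Lemma polygon_kfield m n (L P : set C) : (3 <= m)%N -> (3 <= n)%N ->
  (forall x y, L x -> L y -> Kfield R n (x - y)) ->
  is_affinely_regular_gon m P -> vertices P `<=` L ->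
  kfield R m `<=` kfield R n.
Proof.
move=> m3 n3 LK /affinely_regular_gon_vertices[M [s [c [r [Mu r0 ->]]]]] ML.
have m0 : (0 < m)%N by lia.
pose v j := affine_map M s (c + r * zeta R m ^+ j).
have Lv j : L (v j) by apply: ML; exists (c + r * zeta R m ^+ j) => //; apply: regular_pointsX.
have v10 : v 1 - v 0 != 0.
  rewrite subr_eq0; apply/eqP => /(affine_map_inj Mu) /addrI /(mulfI r0) /eqP.
  rewrite (eq_prim_root_expr (zeta_prim R m0)) !modn_small //; lia.
pose a : R := 1 + 2 * complex.Re (zeta R m).
have aE : a%:C = 1 + (zeta R m + (zeta R m)^*%C).
  by rewrite addcJ /a rmorphD rmorphM rmorph_nat.
(* The index m - 1 plays the part of -1, and z^2 - z^-1 = (1 + z + z^-1)(z - 1). *)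
have av : v 2 - v m.-1 = a%:C * (v 1 - v 0).
  apply: affine_map_parallel.
  have z0 := zeta_neq0 R m.
  have -> : zeta R m ^+ m.-1 = (zeta R m)^-1.
    by apply: (mulfI z0); rewrite divff // -exprS prednK // prim_expr_order // zeta_prim.
  by rewrite aE conj_zeta expr1 expr0; field.
have aK : Kfield R n a%:C.
  have -> : a%:C = (v 2 - v m.-1) / (v 1 - v 0) by rewrite av mulfK.
  by apply/QpredP; rewrite rpred_div //; apply/QpredP; apply: LK.
have ak : kfield R n a%:C by apply: Kfield_real_kfield => //; rewrite conjc_real.
apply: Qadjoin_subset.
have -> : zeta R m + (zeta R m)^*%C = a%:C - 1 by rewrite aE [1 + _]addrC addrK.
by rewrite rpredB ?rpred1 //; apply/QpredP.
Qed.

End Polygons.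

(** * Small integer combinations and real interpolation *)

Section Approximation.
Variable R : realType.
Local Notation C := R[i].

(* Dirichlet's pigeonhole: the (B + 1)^k coefficient vectors in [0, B]^k fall into
   at most (M B + 1)^#|J| cubes of side eta. *)
Lemma small_integer_combination (J : finType) (k : nat) (f : J -> 'I_k -> R) (eta : R) :
  (#|J| < k)%N -> 0 < eta ->
  exists c : 'I_k -> int, (exists i, c i != 0) /\
    forall j, `|\sum_i (c i)%:~R * f j i| < eta.
Proof.
move=> Jk eta0.
pose F := \sum_j \sum_i `|f j i|.
have F0 : 0 <= F by apply: sumr_ge0 => j _; apply: sumr_ge0.
(* F bounds all the sums of |f j i| over i, so after a shift by B F the combinations lie in
   [0, 2 B F], an interval of length at most M B eta. *)
pose M := (Num.truncn (2 * F / eta)).+1.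
have MF : 2 * F <= M%:R * eta.
  by rewrite -ler_pdivrMr // ltW // truncnS_gt.
(* This B makes the count work: (M B + 1)^#|J| is at most (M (B + 1))^#|J| = B (B + 1)^#|J|, which
   is less than (B + 1)^(#|J| + 1). *)
pose B := (M ^ #|J|)%N.
pose g (a : {ffun 'I_k -> 'I_B.+1}) j : R := \sum_i (a i)%:R * f j i + B%:R * F.
have g_bound a j : 0 <= g a j <= 2 * (B%:R * F).
  have h : `|\sum_i (a i)%:R * f j i| <= B%:R * F.
    apply: (le_trans (ler_norm_sum _ _ _)).
    apply: (@le_trans _ _ (\sum_i B%:R * `|f j i|)).
      apply: ler_sum => i _; rewrite normrM normr_nat ler_wpM2r //.
      by rewrite ler_nat -ltnS.
    rewrite -mulr_sumr ler_wpM2l // /F (bigD1 j) //= lerDl.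
    by apply: sumr_ge0 => j' _; apply: sumr_ge0.
  by move: h; rewrite ler_norml /g => /andP[h1 h2]; apply/andP; split; lra.
pose cell a j := Num.truncn (g a j / eta).
have cellP a j : (cell a j)%:R * eta <= g a j < (cell a j).+1%:R * eta.
  have /andP[ga0 _] := g_bound a j.
  have := truncn_itv (divr_ge0 ga0 (ltW eta0)).
  by rewrite ler_pdivlMr // ltr_pdivrMr.
have cellB a j : (cell a j < (M * B).+1)%N.
  rewrite ltnS -(ler_nat R) natrM -(ler_pM2r eta0).
  have /andP[h1 _] := cellP a j; have /andP[_ h2] := g_bound a j.
  apply: (le_trans h1); apply: (le_trans h2).
  by have := ler_wpM2l (ler0n R B) MF; lra.
pose h a : {ffun J -> 'I_(M * B).+1} := [ffun j => Ordinal (cellB a j)].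
have /injectivePn[a [a' aa' hh]] : ~~ injectiveb h.
  apply/negP => /injectiveP/leq_card; rewrite !card_ffun !card_ord leqNgt => /negP; apply.
  have M0 : (0 < M)%N by [].
  apply: (@leq_ltn_trans ((M * B.+1) ^ #|J|)).
    have mono u v e : (u <= v -> u ^ e <= v ^ e)%N by case: e => // e; rewrite leq_exp2r.
    by apply: mono; rewrite mulnS; lia.
  rewrite expnMn -/B; apply: (@leq_trans (B.+1 ^ #|J|.+1)).
    by rewrite expnS ltn_pmul2r ?expn_gt0.
  by rewrite leq_exp2l //; lia.
exists (fun i => (a i)%:Z - (a' i)%:Z); split.
  have /forallPn[i ai] : ~~ [forall i, a i == a' i].
    apply/negP => /forallP e; case/eqP: aa'; apply/ffunP => i; exact/eqP.
  by exists i; rewrite subr_eq0; apply: contraNN ai => /eqP[] e; apply/eqP/val_inj.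
move=> j; have -> : \sum_i ((a i)%:Z - (a' i)%:Z)%:~R * f j i = g a j - g a' j.
  rewrite /g opprD addrACA subrr addr0 -sumrB; apply: eq_bigr => i _.
  by rewrite rmorphB /= mulrBl.
have e : cell a j = cell a' j by move/ffunP: hh => /(_ j); rewrite !ffunE => -[].
have := cellP a j; have := cellP a' j; rewrite e => /andP[h1 h2] /andP[h3 h4].
by rewrite ltr_norml -natr1 mulrDl mul1r in h2 h4 *; apply/andP; split; lra.
Qed.

Local Notation toC := (map_poly (real_complex R)).

Lemma real_coordinates (x w : C) : complex.Im x != 0 ->
  exists a b : R, w = a%:C + b%:C * x.
Proof.
case: x w => [x1 x2] [w1 w2] /= x20; exists (w1 - w2 / x2 * x1), (w2 / x2).
by apply/eqP; rewrite eq_complex /=; apply/andP; split; apply/eqP; field.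
Qed.

(** Lagrange interpolation with real coefficients: the real quadratic with roots x_k and its
    conjugate kills the node k, and a real linear factor takes any complex value at the non-real
    x_j. The bound N is uniform in w, as it later controls a rounding error. *)
Lemma real_interpolation (s : nat) (x : 'I_s -> C) :
  (forall j, complex.Im (x j) != 0) ->
  (forall j k, j != k -> x j != x k /\ x j != (x k)^*%C) ->
  exists N, forall w : 'I_s -> C, exists p : {poly R},
    (size p <= N)%N /\ forall j, (toC p).[x j] = w j.
Proof.
move=> xim xne.
pose quad k : {poly R} := 'X^2 - (2 * complex.Re (x k)) *: 'X +
  (complex.Re (x k) ^+ 2 + complex.Im (x k) ^+ 2)%:P.
have quadE k z : (toC (quad k)).[z] = (z - x k) * (z - (x k)^*%C).
  rewrite /quad rmorphD rmorphB /= map_polyXn map_polyZ /= map_polyX map_polyC /=.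
  rewrite !hornerE; case: (x k) z => [a b] [u v]; apply/eqP.
  by rewrite eq_complex /=; apply/andP; split; apply/eqP; ring.
pose q j := \prod_(k | k != j) quad k.
have qE j z : (toC (q j)).[z] = \prod_(k | k != j) ((z - x k) * (z - (x k)^*%C)).
  by rewrite rmorph_prod horner_prod; apply: eq_bigr => k _; rewrite quadE.
have qj j : (toC (q j)).[x j] != 0.
  rewrite qE; apply/prodf_neq0 => k kj; rewrite eq_sym in kj.
  by have [h1 h2] := xne j k kj; rewrite mulf_neq0 // subr_eq0.
have qk j k : k != j -> (toC (q j)).[x k] = 0.
  by move=> kj; rewrite qE (bigD1 k) //= subrr !mul0r.
exists (\max_j size (q j)).+1 => w.
have /choice[ab abE] j : exists ab : R * R,
    w j / (toC (q j)).[x j] = ab.1%:C + ab.2%:C * x j.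
  by have [a [b ->]] := real_coordinates (w j / (toC (q j)).[x j]) (xim j); exists (a, b).
exists (\sum_j ((ab j).1%:P + (ab j).2 *: 'X) * q j); split.
  apply: (leq_trans (size_sum _ _ _)); apply/bigmax_leqP => j _.
  apply: (leq_trans (size_polyMleq _ _)).
  have : (size ((ab j).1%:P + (ab j).2 *: 'X)%R <= 2)%N.
    apply: (leq_trans (size_polyD _ _)); rewrite geq_max.
    rewrite (leq_trans (size_polyC_leq1 _)) //=.
    by rewrite (leq_trans (size_scale_leq _ _)) // size_polyX.
  have := @leq_bigmax _ (fun j => size (q j)) j; lia.
move=> j; rewrite rmorph_sum horner_sum (bigD1 j) //= big1 ?addr0.
  rewrite rmorphM hornerM rmorphD /= map_polyC map_polyZ map_polyX !hornerE /=.
  by rewrite -abE divfK.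
by move=> k kj; rewrite rmorphM hornerM qk ?mulr0 // eq_sym.
Qed.

End Approximation.

(** * Automorphisms of K_n and their values at zeta_n *)

Section Automorphisms.
Variable R : realType.
Local Notation C := R[i].
Implicit Types (n : nat) (f : C -> C).

Lemma Zpred_inthorner (x : C) (q : {poly int}) : (map_poly intr q).[x] \in Zpred x.
Proof.
apply: rpred_horner; last exact: Zpred_gen.
by apply/polyOverP => i; rewrite coef_map /= rpred_int.
Qed.

Section Fixed.
Variables (n : nat) (f : C -> C).
Hypothesis n0 : (0 < n)%N.
Hypothesis faut : is_automorphism (Kfield R n) f.
Local Notation K := (Kfield R n).

Lemma aut_add x y : K x -> K y -> f (x + y) = f x + f y.
Proof. by case: faut => _ fD _ _ Kx Ky; apply: fD; rewrite inE. Qed.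

Lemma aut_mul x y : K x -> K y -> f (x * y) = f x * f y.
Proof. by case: faut => _ _ fM _ Kx Ky; apply: fM; rewrite inE. Qed.

Lemma aut_inj x y : K x -> K y -> f x = f y -> x = y.
Proof. by case: faut => [[_ fI _]] _ _ _ Kx Ky; apply: fI; rewrite inE. Qed.

Lemma aut_rat q : f (ratr q) = ratr q.
Proof. by case: faut. Qed.

Lemma aut1 : f 1 = 1.
Proof. by have := aut_rat 1; rewrite rmorph1. Qed.

Lemma zeta_Kfield : K (zeta R n).
Proof. exact/QpredP/Qpred_gen. Qed.

(** Membership in K accompanies the induction because f is additive and multiplicative only on K. *)
Lemma aut_ratpoly (p : {poly rat}) :
  K (map_poly ratr p).[zeta R n] /\
  f (map_poly ratr p).[zeta R n] = (map_poly ratr p).[f (zeta R n)].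
Proof.
elim/poly_ind: p => [|p c [Kp IH]].
  rewrite rmorph0 !horner0; split; first exact/QpredP/rpred0.
  by have := aut_rat 0; rewrite rmorph0.
rewrite rmorphD rmorphM /= map_polyX map_polyC !hornerE /=.
have Kc : K (ratr c) by apply/QpredP; apply: rpred_rat.
have Kpz : K ((map_poly ratr p).[zeta R n] * zeta R n).
  by apply/QpredP; rewrite rpredM //; apply/QpredP => //; apply: zeta_Kfield.
split; first by apply/QpredP; rewrite rpredD //; apply/QpredP.
by rewrite aut_add // aut_mul ?IH ?aut_rat //; apply: zeta_Kfield.
Qed.

Lemma ratr_intpoly (q : {poly int}) :
  map_poly (ratr : rat -> C) (map_poly intr q) = map_poly intr q.
Proof. by rewrite -map_poly_comp; apply: eq_map_poly => a; rewrite /= rmorph_int. Qed.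

Lemma aut_intpoly (q : {poly int}) :
  f (map_poly intr q).[zeta R n] = (map_poly intr q).[f (zeta R n)].
Proof. by have [_] := aut_ratpoly (map_poly intr q); rewrite ratr_intpoly. Qed.

Lemma aut_zeta_norm : f (zeta R n) * (f (zeta R n))^*%C = 1.
Proof.
have : f (zeta R n) ^+ n = 1.
  have [_ h] := aut_ratpoly 'X^n; move: h; rewrite map_polyXn !hornerXn => <-.
  by rewrite (prim_expr_order (zeta_prim R n0)) aut1.
move=> /(congr1 Num.norm); rewrite normrX normr1 => /eqP.
by rewrite pexpr_eq1 // -sqr_normc => /eqP ->; rewrite expr1n.
Qed.

(** A real value of absolute value 1 squares to 1; injectivity of f would then give zeta_n^2 = 1. *)
Lemma Im_aut_zeta : (3 <= n)%N -> complex.Im (f (zeta R n)) != 0.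
Proof.
move=> n3; apply/eqP => im0; have := aut_zeta_norm.
have -> : (f (zeta R n))^*%C = f (zeta R n).
  by case: (f _) im0 => a b /= ->; rewrite oppr0.
have K1 : K 1 by apply/QpredP; apply: rpred1.
have Kzz : K (zeta R n * zeta R n).
  by apply/QpredP; rewrite -expr2 rpredX //; apply: Qpred_gen.
rewrite -(aut_mul zeta_Kfield zeta_Kfield) -[RHS]aut1 => /(aut_inj Kzz K1) /eqP.
by rewrite -expr2 -(prim_order_dvd (zeta_prim R n0)) => /dvdn_leq; lia.
Qed.

End Fixed.

Lemma aut_eq n f g : (0 < n)%N -> is_automorphism (Kfield R n) f ->
  is_automorphism (Kfield R n) g -> f (zeta R n) = g (zeta R n) ->
  {in Kfield R n, f =1 g}.
Proof.
move=> n0 faut gaut fg x; rewrite inE => /(Kfield_ratpoly n0)[p ->].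
by rewrite (aut_ratpoly faut p).2 (aut_ratpoly gaut p).2 fg.
Qed.

Lemma aut_eq_conj n f g : (0 < n)%N -> is_automorphism (Kfield R n) f ->
  is_automorphism (Kfield R n) g -> f (zeta R n) = (g (zeta R n))^*%C ->
  {in Kfield R n, f =1 (fun z => (g z)^*%C)}.
Proof.
move=> n0 faut gaut fg x; rewrite inE => /(Kfield_ratpoly n0)[p ->].
rewrite (aut_ratpoly faut p).2 (aut_ratpoly gaut p).2 fg.
rewrite -[RHS](horner_map (@conjc R)) /= -map_poly_comp; congr (_.[_]).
by apply: eq_map_poly => q; rewrite /= [RHS](fmorph_rat (@conjc R)).
Qed.

(** Uniqueness is applied to tau = [sigma k]: the index k qualifies, and j would too if the values
    at zeta_n agreed up to conjugation. *)
Lemma choice_separates n (sigma : 'I_(sdim n).+1 -> C -> C) j k : (0 < n)%N ->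
  is_automorphism_choice sigma -> j != k ->
  sigma j (zeta R n) != sigma k (zeta R n) /\
  sigma j (zeta R n) != (sigma k (zeta R n))^*%C.
Proof.
move=> n0 [saut _ suniq] jk; have [i [_ iuniq]] := suniq _ (saut k).
have ik : i = k by apply: iuniq; left.
split; apply: contra_neq jk => e; rewrite -ik; apply/esym/iuniq.
  by left; apply: aut_eq.
by right; apply: aut_eq_conj.
Qed.

End Automorphisms.

(** * Approximation in the target of the star map *)

Section StarApproximation.
Variable R : realType.
Local Notation C := R[i].

Lemma gt0_real (e : C) : 0 < e -> exists2 d : R, 0 < d & e = d%:C.
Proof.
case: e => a b; rewrite ltcE /= => /andP[/eqP -> a0]; exists a => //.
Qed.

Lemma normc_lt (z : C) (d : R) : `|complex.Re z| < d / 2 -> `|complex.Im z| < d / 2 ->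
  `|z| < d%:C.
Proof.
move=> re im; rewrite [z]complexE; apply: (le_lt_trans (ler_normD _ _)).
rewrite normrM.
have nr (x : R) : `|x%:C| = `|x|%:C by rewrite normc_def /= expr0n addr0 sqrtr_sqr.
have -> : `|'i%C| = 1 :> C by rewrite normc_def /= expr0n add0r expr1n sqrtr1.
by rewrite mul1r !nr -rmorphD ltcR; lra.
Qed.

(* A nonzero cyclotomic integer whose other conjugates are all small: the
   [phi n] integer coordinates outnumber the [phi n - 2] real constraints. *)
Lemma small_conjugates n (sigma : 'I_(sdim n).+1 -> C -> C) (e : C) : (3 <= n)%N ->
  is_automorphism_choice sigma -> 0 < e ->
  exists q : {poly int}, (map_poly intr q).[zeta R n] != 0 /\
    forall j : 'I_(sdim n), `|sigma (lift ord0 j) (map_poly intr q).[zeta R n]| < e.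
Proof.
move=> n3 [saut _ _] /gt0_real[d d0 ->]; have n0 : (0 < n)%N by lia.
pose x j := sigma (lift ord0 j) (zeta R n).
(* Each conjugate yields two real constraints; the flag selects the real or the imaginary part. *)
pose f (jb : 'I_(sdim n) * bool) (i : 'I_(totient n)) : R :=
  if jb.2 then complex.Re (x jb.1 ^+ i) else complex.Im (x jb.1 ^+ i).
have card : (#|{: 'I_(sdim n) * bool}| < totient n)%N.
  rewrite card_prod card_ord card_bool /sdim.
  by have := totient_gt0 n; rewrite n0; lia.
have d2 : 0 < d / 2 by rewrite divr_gt0.
have [c [[i0 ci0] small]] := small_integer_combination f card d2.
pose q : {poly int} := \poly_(i < totient n) (if insub i is Some i' then c i' else 0).
have qE z : (map_poly intr q).[z] = \sum_(i < totient n) (c i)%:~R * z ^+ i :> C.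
  rewrite (horner_coef_wide _ (_ : (_ <= totient n)%N)).
    by apply: eq_bigr => i _; rewrite coef_map coef_poly ltn_ord valK.
  by apply: leq_trans (size_poly _ _); exact: size_poly.
exists q; split.
  (* The degree of q is below phi(n), so a zero value would make all coefficients vanish. *)
  apply: contraNneq ci0 => q0; have := @small_root_prim0 _ n (map_poly intr q) _ (zeta_prim R n0).
  rewrite /root ratr_intpoly q0 eqxx => /(_ _ isT) h.
  have {}h : map_poly intr q = 0 :> {poly rat}.
    by apply: h; apply: leq_trans (size_poly _ _); exact: size_poly.
  have := congr1 (fun p : {poly rat} => p`_i0) h.
  by rewrite coef_map coef0 coef_poly ltn_ord valK /= => /eqP; rewrite intr_eq0.
move=> j; rewrite (aut_intpoly (saut _)) qE -/(x j).
have intE (z : int) : z%:~R = z%:~R%:C :> C by rewrite rmorph_int.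
have sumE (g : C -> R) : (forall a b, g (a + b) = g a + g b) ->
    (forall (a : R) b, g (a%:C * b) = a * g b) ->
    g (\sum_(i < totient n) (c i)%:~R * x j ^+ i) = \sum_i (c i)%:~R * g (x j ^+ i).
  move=> gD gM; have g0 : g 0 = 0 by have := gM 0 0; rewrite mulr0 mul0r.
  rewrite (big_morph g gD g0); apply: eq_bigr => i _; by rewrite intE gM.
apply: normc_lt.
  have := small (j, true); rewrite /f /= sumE //; first by case=> ? ? [].
  by move=> a [b1 b2] /=; rewrite mul0r subr0.
have := small (j, false); rewrite /f /= sumE //; first by case=> ? ? [].
by move=> a [b1 b2] /=; rewrite mul0r addr0.
Qed.

(* Any finite subset of O_n can be moved by a similarity z |-> v + lambda z with
   v, lambda in O_n so that its star image is as close as desired to w: write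
   w / lambda^star as a real combination of stars of powers of zeta_n and round. *)
Lemma star_approximation n (sigma : 'I_(sdim n).+1 -> C -> C) (w : 'I_(sdim n) -> C)
    (e : C) (m : nat) (f : nat -> C) : (3 <= n)%N ->
  is_automorphism_choice sigma -> 0 < e -> (forall i, Kfield R n (f i)) ->
  exists v lambda, [/\ v \in Zpred (zeta R n), lambda \in Zpred (zeta R n), lambda != 0 &
    forall i j, (i < m)%N -> `|w j - sigma (lift ord0 j) (v + lambda * f i)| < e].
Proof.
move=> n3 hs e0 fK; have [saut _ _] := hs; have n0 : (0 < n)%N by lia.
pose x j := sigma (lift ord0 j) (zeta R n).
have xim j : complex.Im (x j) != 0 by apply: (Im_aut_zeta n0 (saut _)).
have xne j k : j != k -> x j != x k /\ x j != (x k)^*%C.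
  by move=> jk; apply: choice_separates => //; rewrite (inj_eq lift_inj).
have xnorm j : `|x j| = 1.
  have := aut_zeta_norm n0 (saut (lift ord0 j)); rewrite -/(x j) -sqr_normc => /eqP.
  by rewrite pexpr_eq1 // => /eqP.
have [N interp] := real_interpolation xim xne.
pose B : C := \sum_j \sum_(i < m) `|sigma (lift ord0 j) (f i)|.
have B0 : 0 <= B by apply: sumr_ge0 => j _; apply: sumr_ge0.
have fB i j : (i < m)%N -> `|sigma (lift ord0 j) (f i)| <= B.
  move=> im; rewrite /B (bigD1 j) //= (bigD1 (Ordinal im)) //= -addrA lerDl.
  by rewrite addr_ge0 ?sumr_ge0 // => k _; apply: sumr_ge0.
(* N bounds the rounding error of N coefficients, the nodes having absolute value 1; B bounds the
   conjugates of the points f i; the 1 keeps T positive. *)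
pose T : C := N%:R + B + 1.
have T0 : 0 < T by rewrite ltr_wpDl // addr_ge0.
have eT : 0 < e / T by rewrite divr_gt0.
have [q [q0 qsmall]] := small_conjugates n3 hs eT.
set lambda := (map_poly intr q).[zeta R n] in q0 qsmall *.
have KZ z : z \in Zpred (zeta R n) -> Kfield R n z.
  by move=> /Zpred_Qpred/QpredP.
have lZ : lambda \in Zpred (zeta R n) by apply: Zpred_inthorner.
have sl0 j : sigma (lift ord0 j) lambda != 0.
  apply: contra_neq q0 => h; apply: (aut_inj (saut (lift ord0 j))).
  - exact: KZ.
  - by apply/QpredP; apply: rpred0.
  - by rewrite h; have := aut_rat (saut (lift ord0 j)) 0; rewrite rmorph0.
(* Rounding down the coefficients of the real interpolant p gives k, and v = lambda k(zeta_n) lies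
   in O_n. All errors then carry the small factor sigma_j(lambda). *)
have [p [pN pE]] := interp (fun j => w j / sigma (lift ord0 j) lambda).
pose k : {poly int} := \poly_(i < N) Num.floor p`_i.
pose v := lambda * (map_poly intr k).[zeta R n].
have kZ : (map_poly intr k).[zeta R n] \in Zpred (zeta R n) by apply: Zpred_inthorner.
exists v, lambda; split => //; first by rewrite /v rpredM.
move=> i j im; set s := sigma (lift ord0 j); have sa : is_automorphism (Kfield R n) s := saut _.
have -> : s (v + lambda * f i) = s lambda * ((map_poly intr k).[x j] + s (f i)).
  have fZ := fK i.
  rewrite /v -mulrDr (aut_mul sa) ?(aut_add sa) ?(aut_intpoly sa) //; try exact: KZ.
  by apply/QpredP; rewrite rpredD //; apply/QpredP => //; apply: KZ.
have -> : w j = s lambda * (map_poly (real_complex R) p).[x j].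
  by rewrite pE mulrC divfK // sl0.
rewrite -mulrBr normrM opprD addrA.
have kp : `|(map_poly (real_complex R) p).[x j] - (map_poly intr k).[x j]| <= N%:R.
  have -> : (map_poly intr k).[x j] = \sum_(l < N) (Num.floor p`_l)%:~R * x j ^+ l.
    rewrite (horner_coef_wide _ (_ : (_ <= N)%N)).
      by apply: eq_bigr => l _; rewrite coef_map coef_poly ltn_ord.
    by apply: leq_trans (size_poly _ _); exact: size_poly.
  rewrite (horner_coef_wide _ (_ : (_ <= N)%N)); last first.
    by apply: leq_trans pN; exact: size_poly.
  rewrite -sumrB; apply: (le_trans (ler_norm_sum _ _ _)).
  rewrite -[N in N%:R](card_ord N) -sumr_const; apply: ler_sum => l _.
  rewrite coef_map -mulrBl normrM normrX xnorm expr1n mulr1 /=.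
  have -> : (Num.floor p`_l)%:~R = ((Num.floor p`_l)%:~R)%:C :> C by rewrite rmorph_int.
  rewrite -rmorphB normc_def /= expr0n addr0 sqrtr_sqr lecR.
  have /andP[h1 h2] := floor_itv p`_l.
  by rewrite intrD1 in h2; rewrite ger0_norm; lra.
apply: (@le_lt_trans _ _ (`|s lambda| * T)).
  rewrite ler_wpM2l //; apply: (le_trans (ler_normB _ _)).
  by apply: (le_trans (lerD kp (fB i j im))); rewrite lerDl.
by rewrite -ltr_pdivlMr //; apply: qsmall.
Qed.

End StarApproximation.

(** * Constructing the polygon in a model set *)

Section ModelSets.
Variable R : realType.
Local Notation C := R[i].

Lemma window_contains_ball s (W : set 'rV[C^o]_s) : is_window W ->
  exists (w : 'I_s -> C) (e : C), 0 < e /\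
    forall z : 'rV[C^o]_s, (forall j, `|w j - z 0 j| < e) -> W z.
Proof.
move=> [[w Ww] _ _]; have /nbhs_ballP[e /= e0 eW] : nbhs w W by [].
exists (fun j => w 0 j), e; split=> // z zw; apply: eW; split => // i j.
by rewrite ord1 -ball_normE /=; apply: zw.
Qed.

Definition mx_columns (p q : C) : 'M[R]_2 :=
  \matrix_(i, j) let z := if j == 0 then p else q in
    if i == 0 then complex.Re z else complex.Im z.

Lemma affine_mx_columns p q s z : affine_map (mx_columns p q) s z =
  (complex.Re z)%:C * p + (complex.Im z)%:C * q + s.
Proof.
rewrite affine_mapE /column !mxE /=.
by case: p q => [p1 p2] [q1 q2].
Qed.

Lemma mx_columns_unit p q :
  complex.Re p * complex.Im q - complex.Im p * complex.Re q != 0 ->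
  mx_columns p q \in unitmx.
Proof.
move=> h; rewrite unitmxE unitfE (expand_det_row _ 0) !big_ord_recl big_ord0.
rewrite /cofactor !det_mx11 !mxE /= addr0 !expr0 expr1 mul1r.
by move: h; congr (_ != 0); ring.
Qed.

(* The real-linear map fixing 1 and sending zeta_m to zeta_n turns the regular
   m-gon into one with vertices in O_n. *)
Definition shear m n (z : C) : C := (complex.Re z)%:C + (complex.Im z)%:C *
  ((zeta R n - (complex.Re (zeta R m))%:C) / (complex.Im (zeta R m))%:C).

(** Powers of zeta_m obey a two-term recursion with the real coefficient tau = zeta_m + zeta_m^-1.
    The real-linear shear preserves it, its first values are 1 and zeta_n, and tau lies in O_n by
    the inclusion of rings. *)
Lemma shear_zetaX m n j : (3 <= m)%N -> oring R m `<=` oring R n ->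
  shear m n (zeta R m ^+ j) \in Zpred (zeta R n).
Proof.
move=> m3 sub; pose tau := zeta R m + (zeta R m)^*%C.
have z0 := zeta_neq0 R m.
have tauZ : tau \in Zpred (zeta R n).
  have /Zadjoin_sub h : zeta R n + (zeta R n)^*%C \in Zpred (zeta R n).
    rewrite conj_zeta rpredD ?Zpred_gen //.
    have [->|n0] := posnP n; last first.
      have -> : (zeta R n)^-1 = zeta R n ^+ n.-1.
        apply: (mulfI (zeta_neq0 R n)).
        by rewrite divff ?zeta_neq0 // -exprS prednK // prim_expr_order // zeta_prim.
      by rewrite rpredX // Zpred_gen.
    (* Since 0 has inverse 0 by convention, [zeta R 0] is 1. *)
    by rewrite /zeta invr0 mulr0 cos0 sin0 invr1 rpred1.
  by apply: h; apply: sub; apply: oring_gen.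
have shearZ (a : R) z : shear m n (a%:C * z) = a%:C * shear m n z.
  rewrite /shear; set q := _ / _.
  case: z q => [z1 z2] [q1 q2]; apply/eqP; rewrite eq_complex /=.
  by apply/andP; split; apply/eqP; ring.
have shearB y z : shear m n (y - z) = shear m n y - shear m n z.
  rewrite /shear; set q := _ / _.
  case: y z q => [y1 y2] [z1 z2] [q1 q2]; apply/eqP; rewrite eq_complex /=.
  by apply/andP; split; apply/eqP; ring.
have tauE : tau = (2 * complex.Re (zeta R m))%:C.
  by rewrite /tau addcJ rmorphM rmorph_nat.
pose P j := shear m n (zeta R m ^+ j) \in Zpred (zeta R n).
suff : P j /\ P j.+1 by case.
elim: j => [|j [Pj Pj1]]; split => //; rewrite /P.
- by rewrite expr0 /shear /= mul0r addr0 rpred1.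
- have im0 : (complex.Im (zeta R m))%:C != 0 :> C.
    by rewrite (inj_eq (@complexI R)) gt_eqF ?Im_zeta_gt0.
  rewrite expr1 /shear mulrCA divff // mulr1 addrCA subrr addr0.
  exact: Zpred_gen.
- have -> : zeta R m ^+ j.+2 = (2 * complex.Re (zeta R m))%:C * zeta R m ^+ j.+1 - zeta R m ^+ j.
    by rewrite -tauE /tau conj_zeta !exprS; field.
  by rewrite shearB shearZ -tauE rpredB // rpredM.
Qed.

Lemma model_set_diff n (L : set C) x y : is_cyclotomic_model_set n L ->
  L x -> L y -> Kfield R n (x - y).
Proof.
move=> [t [W [sigma [_ _ ->]]]] [a [/ZpredP aO _] <-] [b [/ZpredP bO _] <-].
by apply/QpredP; rewrite opprD addrACA subrr add0r rpredB // Zpred_Qpred.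
Qed.

Lemma model_set_gon m n (L : set C) : (3 <= m)%N -> (3 <= n)%N ->
  is_cyclotomic_model_set n L -> oring R m `<=` oring R n ->
  exists P, is_affinely_regular_gon m P /\ is_polygon_in L P.
Proof.
move=> m3 n3 [t [W [sigma [/window_contains_ball[w [e [e0 We]]] hs ->]]]] sub.
have m0 : (0 < m)%N by lia.
have fZ := fun j => shear_zetaX j m3 sub.
have fK j : Kfield R n (shear m n (zeta R m ^+ j)).
  by apply/QpredP/Zpred_Qpred.
have [v [l [vZ lZ l0 close]]] := star_approximation w m n3 hs e0 fK.
(* q is the image of i under the shear, so the columns l and l q describe the shear followed by
   multiplication by l; the determinant is |l|^2 Im q. *)
pose q := (zeta R n - (complex.Re (zeta R m))%:C) / (complex.Im (zeta R m))%:C.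
have qE : complex.Im q = complex.Im (zeta R n) / complex.Im (zeta R m).
  rewrite /q -fmorphV; case: (zeta R n) => a b /=; ring.
apply: (@affine_image_regular_gon _ m (mx_columns l (l * q)) (t + v)) => //.
  apply: mx_columns_unit.
  have -> : complex.Re l * complex.Im (l * q) - complex.Im l * complex.Re (l * q) =
      (complex.Re l ^+ 2 + complex.Im l ^+ 2) * complex.Im q.
    by move: q {qE} => q; case: l q {lZ l0 close} => [l1 l2] [q1 q2] /=; ring.
  rewrite mulf_neq0 //.
    rewrite paddr_eq0 ?sqr_ge0 // !sqrf_eq0; apply: contra l0 => /andP[l1 l2].
    by rewrite eq_complex l1 l2.
  by rewrite qE mulf_neq0 ?invr_eq0 // gt_eqF ?Im_zeta_gt0.
move=> j; exists (v + l * shear m n (zeta R m ^+ j)); last first.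
  rewrite affine_mx_columns /shear -/q; move: (zeta R m ^+ j) => z.
  move: (complex.Re z)%:C (complex.Im z)%:C => a b; ring.
split; first by apply/ZpredP; rewrite rpredD // rpredM.
apply: We => k; rewrite mxE.
(* The approximation covers only exponents below m. *)
have -> : zeta R m ^+ j = zeta R m ^+ (j %% m) by rewrite prim_expr_mod // zeta_prim.
by apply: close; rewrite ltn_mod.
Qed.

End ModelSets.

Theorem corollary4p1 (R : realType) (m n : nat) (L : set R[i])
    (hm : (3 <= m)%N) (hn : (3 <= n)%N)
    (hL : is_cyclotomic_model_set n L) :
  [<-> (* (i) *) exists P : set R[i],
         is_affinely_regular_gon m P /\ is_polygon_in L P;
       (* (ii) *) kfield R m `<=` kfield R n;
       (* (iii) *) m \in [:: 3; 4; 6]%N \/ Kfield R m `<=` Kfield R n;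
       (* (iv) *) [\/ m \in [:: 3; 4; 6]%N, (m %| n)%N |
         exists d : nat, [/\ odd d, (d %| n)%N & m = (2 * d)%N]];
       (* (v) *) m \in [:: 3; 4; 6]%N \/ Oring R m `<=` Oring R n;
       (* (vi) *) oring R m `<=` oring R n].
Proof.
have n0 : (0 < n)%N by lia.
(* The implications from (ii) to (iii) and from (v) to (vi) both pass through the arithmetic
   condition (iv), which follows from (ii) and yields the ring inclusions. *)
tfae.
- move=> [P [gonP [_ PL]]]; apply: polygon_kfield hm hn _ gonP PL => x y.
  exact: model_set_diff.
- move=> /(kfield_sub_dvd hm hn) /(Oring_subset R n0) [|/Kfield_of_Oring];
    by [left | right].
- by move=> /(kfield_of_Kfield hn) /(kfield_sub_dvd hm hn).
- exact: Oring_subset.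
- move=> h; apply: oring_subset => //; apply: (@kfield_sub_dvd R _ _ hm hn).
  by apply: kfield_of_Kfield => //; case: h => [|/Kfield_of_Oring]; [left | right].
- exact: model_set_gon.
Qed.
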